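(* Let $\mathcal{V}\subseteq TM$ be a subbundle and $\sigma\in\Omega^2(M)$ such that $\sigma|_{\wedge^2\mathcal{V}}$ is non degenerate and $TM=\mathcal{V}\oplus\ker\flat_\sigma$. The skew classical, generalized F-structure defined by the pair $(\mathcal{V},\sigma)$ is a generalized CRF-structure if and only if $\mathcal{V}$ is a foliation (i.e. involutive) and $\sigma$ satisfies the condition $$i(X\wedge Y)d\sigma=0,\qquad\forall X,Y\in\mathcal{V}.$$
   Context: $M$ is a $C^\infty$ manifold, $T^{big}M=TM\oplus T^*M$ with the metric $g((X,\alpha),(Y,\beta))=\frac12(\alpha(Y)+\beta(X))$ and the Courant bracket $[(X,\alpha),(Y,\beta)]=([X,Y],L_X\beta-L_Y\alpha+\frac12 d(\alpha(Y)-\beta(X)))$, extended complex (bi)linearly to $T^{big}_cM=T^{big}M\otimes\mathbb{C}$. A generalized F-structure is a $g$-skew-symmetric endomorphism $\Phi$ of $T^{big}M$ with $\Phi^3+\Phi=0$; it is a generalized CRF-structure if the space of sections of its $\sqrt{-1}$-eigenbundle $E\subseteq T^{big}_cM$ is closed under the Courant bracket. It is skew classical if $\Phi(TM)\subseteq T^*M$, $\Phi(T^*M)\subseteq TM$; then $\Phi(X,\alpha)=(\sharp_\pi\alpha,\flat_\sigma X)$ with $\flat_\sigma X=i(X)\sigma$, $\sharp_\pi\alpha=i(\alpha)\pi$, $\sigma$ a $2$-form, $\pi$ a bivector field. The structure defined by a pair $(\mathcal{V},\sigma)$ as in the claim is the one with this $\sigma$ and with $\pi$ determined as follows: put $\Sigma=\flat_\sigma(\mathcal{V})=im\,\flat_\sigma$,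 so that $T^*M=\Sigma\oplus ann\,\mathcal{V}$; then $\sharp_\pi|_\Sigma=-(\flat_\sigma|_{\mathcal{V}})^{-1}$ and $\sharp_\pi|_{ann\,\mathcal{V}}=0$. The condition $i(X\wedge Y)d\sigma=0$ means $d\sigma(X,Y,Z)=0$ for all tangent vectors $Z$. *)

(* Defs.v *)
From HB Require Import structures.
From mathcomp Require Import all_boot all_order all_algebra.
From mathcomp Require Import all_classical all_reals all_analysis.
From mathcomp Require Import ring.

Set Implicit Arguments.
Unset Strict Implicit.
Unset Printing Implicit Defensive.

Import Order.TTheory GRing.Theory Num.Theory numFieldNormedType.Exports.

Local Open Scope classical_set_scope.
Local Open Scope ring_scope.

Section EuclideanSmoothness.
Variables (R : realType) (n : nat).
Implicit Types (U : set 'rV[R]_n) (f g : 'rV[R]_n -> R).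

(* Only meant for open [U]; [f] is arbitrary outside [U]. *)
Fixpoint Ck (k : nat) U f : Prop :=
  (forall x, U x -> {for x, continuous f}) /\
  match k with
  | 0 => True
  | k'.+1 => forall i : 'I_n,
      (forall x, U x -> derivable f x (delta_mx 0 i)) /\
      Ck k' U ('D_(delta_mx 0 i) f)
  end.

Definition smooth_on U f : Prop := forall k, Ck k U f.

Lemma Ck_ext U f g k : open U -> (forall x, U x -> f x = g x) ->
  Ck k U f -> Ck k U g.
Proof.
move=> oU.
have near_eq (f' g' : 'rV[R]_n -> R) x :
    (forall x, U x -> f' x = g' x) -> U x -> \near x, f' x = g' x.
  by move=> fg Ux; apply: filterS (open_nbhs_nbhs (conj oU Ux)) => y /fg.
have cont (f' g' : 'rV[R]_n -> R) : (forall x, U x -> f' x = g' x) ->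
    (forall x, U x -> {for x, continuous f'}) ->
    forall x, U x -> {for x, continuous g'}.
  move=> fg cf x Ux; rewrite /prop_for /continuous_at -fg//.
  exact: cvg_trans (near_eq_cvg (near_eq f' g' x fg Ux)) (cf _ Ux).
elim: k f g => [|k IH] f g fg [cf df]; split=> //; try exact: cont cf.
move=> i; have [di Di] := df i; split.
  by move=> x Ux; apply: near_eq_derivable (di _ Ux); exact: (near_eq f g).
by apply: IH Di => x Ux; apply: near_eq_derive; exact: (near_eq f g).
Qed.

Lemma CkW U f k : Ck k.+1 U f -> Ck k U f.
Proof.
elim: k f => [|k IH] f /= [cf df]; split=> // i.
by have [di Di] := df i; split=> //; exact: IH.
Qed.

Lemma Ck_cst U (a : R) k : open U -> Ck k U (cst a).
Proof.
move=> oU; elim: k a => [|k IH] a; (split=> [x _|]; first exact: cst_continuous) => //.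
move=> i; split; first by move=> x _; exact: (derivable_cst a).
by apply: Ck_ext (IH 0) => // x _; rewrite derive_cst.
Qed.

Lemma CkD U f g k : open U -> Ck k U f -> Ck k U g -> Ck k U (f + g).
Proof.
move=> oU; elim: k f g => [|k IH] f g [cf df] [cg dg]; split=> //.
1,2: by move=> x Ux; exact: cvgD (cf _ Ux) (cg _ Ux).
move=> i; have [di Di] := df i; have [ei Ei] := dg i; split.
  by move=> x Ux; apply: derivableD; [exact: di|exact: ei].
apply: Ck_ext (IH _ _ Di Ei) => // x Ux.
by rewrite deriveD//; [exact: di|exact: ei].
Qed.

Lemma CkM U f g k : open U -> Ck k U f -> Ck k U g -> Ck k U (f * g).
Proof.
move=> oU; elim: k f g => [|k IH] f g Cf Cg.
  by split=> // x Ux; exact: cvgM (Cf.1 _ Ux) (Cg.1 _ Ux).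
have [[cf df] [cg dg]] := (Cf, Cg); split.
  by move=> x Ux; exact: cvgM (cf _ Ux) (cg _ Ux).
move=> i; have [di Di] := df i; have [ei Ei] := dg i; split.
  by move=> x Ux; apply: derivableM; [exact: di|exact: ei].
apply: Ck_ext (CkD oU (IH _ _ (CkW Cf) Ei) (IH _ _ (CkW Cg) Di)) => // x Ux.
by rewrite deriveM//; [exact: di|exact: ei].
Qed.

End EuclideanSmoothness.

Section Manifold.
Variables (R : realType) (n : nat).

(* [cmap] and [cinv] are only meaningful on [cdom] and on [cmap @` cdom]. *)
Record chart (T : topologicalType) := Chart {
  cdom : set T;
  cmap : T -> 'rV[R]_n;
  cinv : 'rV[R]_n -> T;
  cdom_open : open cdom;
  cimg_open : open (cmap @` cdom);
  cmapK : forall p, cdom p -> cinv (cmap p) = p;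
  cmap_cont : forall p, cdom p -> {for p, continuous cmap};
  cinv_cont : forall x, (cmap @` cdom) x -> {for x, continuous cinv} }.

Record manifold := Manifold {
  points :> topologicalType;
  points_hausdorff : hausdorff_space points;
  points_second_countable : @second_countable points;
  atlas : set (chart points);
  atlas_cover : forall p, exists2 c, atlas c & cdom c p;
  atlas_compat : forall c c', atlas c -> atlas c' -> forall i : 'I_n,
    smooth_on (cmap c @` (cdom c `&` cdom c'))
      (fun x => cmap c' (cinv c x) 0 i) }.

End Manifold.

Section SmoothFunctions.
Variables (R : realType) (n : nat) (M : manifold R n).

Definition smooth (f : M -> R) : Prop :=
  forall c, atlas c -> smooth_on (cmap c @` cdom c) (f \o cinv c).

Definition smooth_pred : {pred (M -> R)} := [pred f | `[< smooth f >]].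

Lemma smooth_predP f : reflect (smooth f) (f \in smooth_pred).
Proof. exact: asboolP. Qed.

Lemma smooth_cst (a : R) : smooth (cst a).
Proof. by move=> c _ k; apply: (@Ck_cst _ _ _ a); exact: cimg_open. Qed.

Lemma smoothD f g : smooth f -> smooth g -> smooth (f + g).
Proof.
move=> sf sg c Mc k.
exact: (@CkD _ _ _ (f \o cinv c) (g \o cinv c) k (@cimg_open _ _ _ c) (sf c Mc k)
         (sg c Mc k)).
Qed.

Lemma smoothM f g : smooth f -> smooth g -> smooth (f * g).
Proof.
move=> sf sg c Mc k.
exact: (@CkM _ _ _ (f \o cinv c) (g \o cinv c) k (@cimg_open _ _ _ c) (sf c Mc k)
         (sg c Mc k)).
Qed.

Lemma smoothZ a f : smooth f -> smooth (a *: f).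
Proof. exact: (smoothM (smooth_cst a)). Qed.

Lemma smoothB f g : smooth f -> smooth g -> smooth (f - g).
Proof. by move=> sf sg; rewrite -scaleN1r; exact: smoothD (smoothZ _ sg). Qed.

Lemma smooth_subring : subring_closed smooth_pred.
Proof.
split; first by apply/smooth_predP; exact: smooth_cst.
  by move=> f g /smooth_predP ? /smooth_predP ?; apply/smooth_predP/smoothB.
by move=> f g /smooth_predP ? /smooth_predP ?; apply/smooth_predP/smoothM.
Qed.

Lemma smooth_submod : submod_closed smooth_pred.
Proof.
split; first by apply/smooth_predP; exact: (smooth_cst 0).
move=> a f g /smooth_predP sf /smooth_predP sg; apply/smooth_predP.
exact: smoothD (smoothZ a sf) sg.
Qed.

HB.instance Definition _ :=
  GRing.isSubringClosed.Build (M -> R) smooth_pred smooth_subring.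
HB.instance Definition _ :=
  GRing.isSubmodClosed.Build R (M -> R) smooth_pred smooth_submod.

Record smoothfun := SmoothFun {
  smoothfun_val :> M -> R; _ : smoothfun_val \in smooth_pred }.
HB.instance Definition _ := [isSub for smoothfun_val].
HB.instance Definition _ := [Choice of smoothfun by <:].
HB.instance Definition _ :=
  GRing.SubChoice_isSubComPzRing.Build _ _ smoothfun (GRing.subringClosedP _).
HB.instance Definition _ := [SubZmodule_isSubLmodule of smoothfun by <:].

Lemma smoothfunDE (f g : smoothfun) p : (f + g) p = f p + g p.
Proof. by have /(congr1 (@^~ p)) := raddfD (val : smoothfun -> _) f g. Qed.

Lemma smoothfunPE a (f g : smoothfun) p : (a *: f + g) p = a * f p + g p.
Proof. by have /(congr1 (@^~ p)) := linearP (val : smoothfun -> _) a f g. Qed.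

Lemma smoothfunME (f g : smoothfun) p : (f * g) p = f p * g p.
Proof. by have /(congr1 (@^~ p)) := rmorphM (val : smoothfun -> _) f g. Qed.

Definition SmoothFunOf f (sf : smooth f) : smoothfun :=
  SmoothFun (introT (smooth_predP f) sf).

Lemma smoothfunP (f : smoothfun) : smooth f.
Proof. by case: f => f /= /smooth_predP. Qed.

Lemma smoothfun_eq (f g : smoothfun) : (forall p, f p = g p) -> f = g.
Proof. by move=> fg; apply: val_inj; apply/funext. Qed.

End SmoothFunctions.

Section Dual.
Variables (R : realType) (W : lmodType R).

Definition linear_pred : {pred (W -> R)} := [pred l | `[<
  forall (a : R) u v, l (a *: u + v) = a * l u + l v >]].

Lemma linear_submod : submod_closed linear_pred.
Proof.
split; first by apply/asboolP => a u v /=; rewrite mulr0 addr0.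
move=> a l m /asboolP ll /asboolP lm; apply/asboolP => b u v /=.
change (a * l (b *: u + v) + m (b *: u + v) =
        b * (a * l u + m u) + (a * l v + m v)).
by rewrite ll lm; ring.
Qed.

HB.instance Definition _ :=
  GRing.isSubmodClosed.Build R (W -> R) linear_pred linear_submod.

Record dual := Dual { dual_val :> W -> R; _ : dual_val \in linear_pred }.
HB.instance Definition _ := [isSub for dual_val].
HB.instance Definition _ := [Choice of dual by <:].
HB.instance Definition _ :=
  GRing.SubChoice_isSubLmodule.Build _ _ _ dual (GRing.subsemimodClosedP _).

Lemma dual0E u : (0 : dual) u = 0.
Proof. by have /(congr1 (@^~ u)) := raddf0 (val : dual -> _). Qed.

Lemma dualPE a (l m : dual) u : (a *: l + m) u = a * l u + m u.
Proof. by have /(congr1 (@^~ u)) := linearP (val : dual -> _) a l m. Qed.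

Definition DualOf (l : W -> R)
  (ll : forall (a : R) u v, l (a *: u + v) = a * l u + l v) : dual :=
  Dual (introT (asboolP _) ll : l \in linear_pred).

End Dual.

Section Tangent.
Variables (R : realType) (n : nat) (M : manifold R n).

Definition is_derivation (p : M) (D : smoothfun M -> R) : Prop :=
  (forall (a : R) f g, D (a *: f + g) = a * D f + D g) /\
  (forall f g, D (f * g) = f p * D g + g p * D f).

Definition derivation_pred p : {pred (smoothfun M -> R)} :=
  [pred D | `[< is_derivation p D >]].

Lemma derivation_submod p : submod_closed (derivation_pred p).
Proof.
split; first by apply/asboolP; split=> [a f g|f g] /=; rewrite !mulr0 addr0.
move=> a D E /asboolP[lD mD] /asboolP[lE mE]; apply/asboolP; split.
  move=> b f g; change (a * D (b *: f + g) + E (b *: f + g) =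
    b * (a * D f + E f) + (a * D g + E g)).
  by rewrite lD lE; ring.
move=> f g; change (a * D (f * g) + E (f * g) =
  f p * (a * D g + E g) + g p * (a * D f + E f)).
by rewrite mD mE; ring.
Qed.

HB.instance Definition _ p :=
  GRing.isSubmodClosed.Build R (smoothfun M -> R) (derivation_pred p)
    (derivation_submod p).

Record tangent (p : M) := Tangent {
  tangent_val :> smoothfun M -> R; _ : tangent_val \in derivation_pred p }.
HB.instance Definition _ p := [isSub for @tangent_val p].
HB.instance Definition _ p := [Choice of tangent p by <:].
HB.instance Definition _ p :=
  GRing.SubChoice_isSubLmodule.Build _ _ _ (tangent p) (GRing.subsemimodClosedP _).

Definition TangentOf p D (dD : is_derivation p D) : tangent p :=
  Tangent (introT (asboolP _) dD : D \in derivation_pred p).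

Lemma tangentP p (v : tangent p) : is_derivation p v.
Proof. by case: v => D /= /asboolP. Qed.

Lemma tangent0E p f : (0 : tangent p) f = 0.
Proof. by have /(congr1 (@^~ f)) := raddf0 (val : tangent p -> _). Qed.

Lemma tangentPE p a (u v : tangent p) f : (a *: u + v) f = a * u f + v f.
Proof. by have /(congr1 (@^~ f)) := linearP (val : tangent p -> _) a u v. Qed.

Definition cotangent (p : M) := dual (tangent p).
HB.instance Definition _ p := GRing.Lmodule.on (cotangent p).

End Tangent.

Section DependentFunctions.
Variables (R : realType) (T : Type) (W : T -> lmodType R).

Definition depfun := forall t, W t.
HB.instance Definition _ := gen_eqMixin depfun.
HB.instance Definition _ := gen_choiceMixin depfun.

Implicit Types s : depfun.
Let zero : depfun := fun t => 0.
Let opp s : depfun := fun t => - s t.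
Let add s s' : depfun := fun t => s t + s' t.
Let scale (a : R) s : depfun := fun t => a *: s t.

Let addA : associative add.
Proof. by move=> *; apply: functional_extensionality_dep => t; exact: addrA. Qed.
Let addC : commutative add.
Proof. by move=> *; apply: functional_extensionality_dep => t; exact: addrC. Qed.
Let add0 : left_id zero add.
Proof. by move=> *; apply: functional_extensionality_dep => t; exact: add0r. Qed.
Let addN : left_inverse zero opp add.
Proof. by move=> *; apply: functional_extensionality_dep => t; exact: addNr. Qed.
HB.instance Definition _ := GRing.isZmodule.Build depfun addA addC add0 addN.

Let scaleA a b s : scale a (scale b s) = scale (a * b) s.
Proof. by apply: functional_extensionality_dep => t; exact: scalerA. Qed.
Let scale1 : left_id 1 scale.
Proof. by move=> s; apply: functional_extensionality_dep => t; exact: scale1r. Qed.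
Let scaleDr : right_distributive scale +%R.
Proof. by move=> *; apply: functional_extensionality_dep => t; exact: scalerDr. Qed.
Let scaleDl s : {morph scale^~ s : a b / a + b}.
Proof. by move=> *; apply: functional_extensionality_dep => t; exact: scalerDl. Qed.
HB.instance Definition _ :=
  GRing.Zmodule_isLmodule.Build R depfun scaleA scale1 scaleDr scaleDl.

End DependentFunctions.

Section Fields.
Variables (R : realType) (n : nat) (M : manifold R n).

Local Notation rough_field := (depfun (fun p : M => tangent p : lmodType R)).
Local Notation rough_form := (depfun (fun p : M => cotangent p : lmodType R)).

Definition vf_pred : {pred rough_field} := [pred X : rough_field | `[<
  forall f : smoothfun M, smooth (fun p => X p f) >]].

Lemma vf_submod : submod_closed vf_pred.
Proof.
split.
  apply/asboolP => f; suff -> : (fun p => (0 : tangent p) f) = cst 0.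
    exact: smooth_cst.
  by apply/funext => p; rewrite tangent0E.
move=> a X Y /asboolP sX /asboolP sY; apply/asboolP => f.
suff -> : (fun p => (a *: X p + Y p) f) = a *: (fun p => X p f) + (fun p => Y p f).
  exact: smoothD (smoothZ a (sX f)) (sY f).
by apply/funext => p; rewrite tangentPE.
Qed.

HB.instance Definition _ :=
  GRing.isSubmodClosed.Build R rough_field vf_pred vf_submod.

Record vector_field := VectorField {
  vf_val : rough_field; _ : vf_val \in vf_pred }.
HB.instance Definition _ := [isSub for vf_val].
HB.instance Definition _ := [Choice of vector_field by <:].
HB.instance Definition _ :=
  GRing.SubChoice_isSubLmodule.Build _ _ _ vector_field (GRing.subsemimodClosedP _).

Definition vf_at (X : vector_field) (p : M) : tangent p := vf_val X p.
Coercion vf_at : vector_field >-> Funclass.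

Lemma vfP (X : vector_field) (f : smoothfun M) : smooth (fun p => X p f).
Proof. by case: X => X /= /asboolP. Qed.

Definition vf_app (X : vector_field) (f : smoothfun M) : smoothfun M :=
  SmoothFunOf (vfP X f).

Definition form_pred : {pred rough_form} := [pred a : rough_form | `[<
  forall X : vector_field, smooth (fun p => a p (X p)) >]].

Lemma form_submod : submod_closed form_pred.
Proof.
split.
  apply/asboolP => X; suff -> : (fun p => (0 : cotangent p) (X p)) = cst 0.
    exact: smooth_cst.
  by apply/funext => p; rewrite dual0E.
move=> a b c /asboolP sb /asboolP sc; apply/asboolP => X.
suff -> : (fun p => (a *: b p + c p) (X p)) =
    a *: (fun p => b p (X p)) + (fun p => c p (X p)).
  exact: smoothD (smoothZ a (sb X)) (sc X).
by apply/funext => p; rewrite dualPE.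
Qed.

HB.instance Definition _ :=
  GRing.isSubmodClosed.Build R rough_form form_pred form_submod.

Record one_form := OneForm {
  form_val : rough_form; _ : form_val \in form_pred }.
HB.instance Definition _ := [isSub for form_val].
HB.instance Definition _ := [Choice of one_form by <:].
HB.instance Definition _ :=
  GRing.SubChoice_isSubLmodule.Build _ _ _ one_form (GRing.subsemimodClosedP _).

Definition form_at (a : one_form) (p : M) : cotangent p := form_val a p.
Coercion form_at : one_form >-> Funclass.

Lemma formP (a : one_form) (X : vector_field) : smooth (fun p => a p (X p)).
Proof. by case: a => a /= /asboolP. Qed.

Definition form_app (a : one_form) (X : vector_field) : smoothfun M :=
  SmoothFunOf (formP a X).

Lemma vf_appP (X : vector_field) a f g :
  vf_app X (a *: f + g) = a *: vf_app X f + vf_app X g.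
Proof.
apply: smoothfun_eq => p; rewrite smoothfunPE /=.
by have [-> _] := tangentP (X p).
Qed.

Lemma vf_appM (X : vector_field) f g :
  vf_app X (f * g) = f * vf_app X g + g * vf_app X f.
Proof.
apply: smoothfun_eq => p; rewrite smoothfunDE !smoothfunME /=.
by have [_ ->] := tangentP (X p).
Qed.

Fact lie_bracket_derivation (X Y : vector_field) p :
  is_derivation p (fun f => X p (vf_app Y f) - Y p (vf_app X f)).
Proof.
have [lX mX] := tangentP (X p); have [lY mY] := tangentP (Y p).
split=> [a f g|f g]; first by rewrite !vf_appP lX lY; ring.
have addX f' g' : X p (f' + g') = X p f' + X p g'.
  by rewrite -[f']scale1r lX mul1r scale1r.
have addY f' g' : Y p (f' + g') = Y p f' + Y p g'.
  by rewrite -[f']scale1r lY mul1r scale1r.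
by rewrite !vf_appM addX addY !mX !mY /=; ring.
Qed.

Fact lie_bracket_smooth (X Y : vector_field) :
  ((fun p => TangentOf (lie_bracket_derivation X Y p)) : rough_field)
    \in vf_pred.
Proof.
apply/asboolP => f.
exact: smoothB (vfP X (vf_app Y f)) (vfP Y (vf_app X f)).
Qed.

Definition lie_bracket (X Y : vector_field) : vector_field :=
  VectorField (lie_bracket_smooth X Y).

Fact differential_linear (f : smoothfun M) p (a : R) (u v : tangent p) :
  (a *: u + v) f = a * u f + v f.
Proof. exact: tangentPE. Qed.

Fact differential_smooth (f : smoothfun M) :
  ((fun p => DualOf (@differential_linear f p)) : rough_form) \in form_pred.
Proof. by apply/asboolP => X; exact: vfP. Qed.

Definition differential (f : smoothfun M) : one_form :=
  OneForm (differential_smooth f).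

(* [L_X b] is the only 1-form [c] with [c Z = X (b Z) - b [X, Z]] for every
   vector field [Z]: the right-hand side is C^oo(M)-linear in [Z].  The default
   value [0] of [xget] is never used. *)
Definition lie_derivative (X : vector_field) (b : one_form) : one_form :=
  xget 0 [set c : one_form | forall Z : vector_field,
    form_app c Z = vf_app X (form_app b Z) - form_app b (lie_bracket X Z)].

End Fields.

Section TwoForms.
Variables (R : realType) (n : nat) (M : manifold R n).

Record two_form := TwoForm {
  tf_at :> forall p : M, tangent p -> tangent p -> R;
  tf_linear : forall p (a : R) (u v w : tangent p),
    tf_at (a *: u + v) w = a * tf_at u w + tf_at v w;
  tf_skew : forall p (u v : tangent p), tf_at u v = - tf_at v u;
  tf_smooth : forall X Y : vector_field M,
    smooth (fun p => tf_at (X p) (Y p)) }.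

Implicit Types (s : two_form) (X Y Z : vector_field M).

Definition tf_app s X Y : smoothfun M := SmoothFunOf (tf_smooth s X Y).

Fact flat_linear s p (u : tangent p) (a : R) (v w : tangent p) :
  s p u (a *: v + w) = a * s p u v + s p u w.
Proof.
by rewrite tf_skew tf_linear [in RHS](tf_skew s u) [s p u w]tf_skew; ring.
Qed.

Definition flat s p (u : tangent p) : cotangent p := DualOf (flat_linear s u).

(* [ext_deriv s X Y Z p] only depends on [X p], [Y p] and [Z p]. *)
Definition ext_deriv s X Y Z : smoothfun M :=
  vf_app X (tf_app s Y Z) - vf_app Y (tf_app s X Z) + vf_app Z (tf_app s X Y)
  - tf_app s (lie_bracket X Y) Z + tf_app s (lie_bracket X Z) Y
  - tf_app s (lie_bracket Y Z) X.

End TwoForms.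

(* [cplx W] is the complexification of a real vector space [W]: the pair
   [(a, b)] stands for [a + i b]. *)
Definition cplx (W : Type) : Type := (W * W)%type.
Definition cplx_map (W W' : Type) (f : W -> W') (z : cplx W) : cplx W' :=
  (f z.1, f z.2).
Definition cplx_muli (W : zmodType) (z : cplx W) : cplx W := (- z.2, z.1).
Definition cplx_bilin (W : zmodType) (f : W -> W -> W) (z z' : cplx W) :
  cplx W := (f z.1 z'.1 - f z.2 z'.2, f z.1 z'.2 + f z.2 z'.1).

Section GeneralizedStructures.
Variables (R : realType) (n : nat) (M : manifold R n).

Definition big_tangent (p : M) : Type := (tangent p * cotangent p)%type.
HB.instance Definition _ p := GRing.Lmodule.on (big_tangent p).

Definition big_section : Type := (vector_field M * one_form M)%type.
HB.instance Definition _ := GRing.Lmodule.on big_section.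

Definition big_at (A : big_section) (p : M) : big_tangent p := (A.1 p, A.2 p).

Definition metric p (a b : big_tangent p) : R := 2^-1 * (a.2 b.1 + b.2 a.1).

Definition courant (A B : big_section) : big_section :=
  (lie_bracket A.1 B.1,
   lie_derivative A.1 B.2 - lie_derivative B.1 A.2
   + 2^-1 *: differential (form_app A.2 B.1 - form_app B.2 A.1)).

Definition big_map := forall p, big_tangent p -> big_tangent p.

Definition is_endomorphism (Phi : big_map) : Prop :=
  (forall p (a : R) (u v : big_tangent p),
    Phi p (a *: u + v) = a *: Phi p u + Phi p v) /\
  (forall A : big_section, exists B : big_section,
    forall p, big_at B p = Phi p (big_at A p)).

Definition generalized_F (Phi : big_map) : Prop :=
  [/\ is_endomorphism Phi,
      forall p (u v : big_tangent p),
        metric (Phi p u) v + metric u (Phi p v) = 0 &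
      forall p (u : big_tangent p), Phi p (Phi p (Phi p u)) + Phi p u = 0].

Definition i_eigenbundle (Phi : big_map) (p : M) : set (cplx (big_tangent p)) :=
  [set z | cplx_map (Phi p) z = cplx_muli z].

Definition is_section_of (E : forall p : M, set (cplx (big_tangent p)))
    (A : cplx big_section) : Prop :=
  forall p, E p (cplx_map (big_at^~ p) A).

Definition generalized_CRF (Phi : big_map) : Prop :=
  generalized_F Phi /\
  forall A B : cplx big_section,
    is_section_of (i_eigenbundle Phi) A -> is_section_of (i_eigenbundle Phi) B ->
    is_section_of (i_eigenbundle Phi) (cplx_bilin courant A B).

(* Local frames are taken among restrictions of global vector fields, which is
   no loss: a frame on [U] can be cut off by a bump function around [p].  The
   rank is only required to be locally constant. *)
Definition is_subbundle (V : forall p : M, set (tangent p)) : Prop :=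
  forall p : M, exists (U : set M) (r : nat) (X : 'I_r -> vector_field M),
    [/\ open U, U p &
        forall q, U q ->
          V q = [set \sum_i c 0 i *: X i q | c in [set: 'rV[R]_r]] /\
          forall c : 'rV[R]_r, \sum_i c 0 i *: X i q = 0 -> c = 0].

Definition involutive_subbundle (V : forall p : M, set (tangent p)) : Prop :=
  forall X Y : vector_field M, (forall p, V p (X p)) -> (forall p, V p (Y p)) ->
    forall p, V p (lie_bracket X Y p).

Definition nondegenerate_on (s : two_form M)
    (V : forall p : M, set (tangent p)) : Prop :=
  forall p (u : tangent p), V p u -> (forall v, V p v -> s p u v = 0) -> u = 0.

Definition ker_flat (s : two_form M) (p : M) : set (tangent p) :=
  [set u | flat s u = 0].

Definition direct_sum (W : lmodType R) (A B : set W) : Prop :=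
  forall w : W, exists! ab : W * W, [/\ A ab.1, B ab.2 & w = ab.1 + ab.2].

Definition ann (V : forall p : M, set (tangent p)) (p : M) :
  set (cotangent p) := [set a | forall v, V p v -> a v = 0].

(* Decompose [a] as [flat s v + b] along T*M = flat s (V) + ann V and send it
   to [- v].  If [s] is nondegenerate on [V] and TM = V + ker (flat s), then
   exactly one [u] satisfies the specification and the default value [0] of
   [xget] is never used. *)
Definition sharp (V : forall p : M, set (tangent p)) (s : two_form M)
    (p : M) (a : cotangent p) : tangent p :=
  xget 0 [set u : tangent p | exists v b,
    [/\ V p v, ann V b, a = flat s v + b & u = - v]].

Definition skew_classical_structure (V : forall p : M, set (tangent p))
    (s : two_form M) : big_map :=
  fun p w => (sharp V s w.2, flat s w.1).

End GeneralizedStructures.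

Arguments ker_flat {R n M} s p.

(* Main.v *)
(** The sections of the [i]-eigenbundle are the [(X, - i flat X)] with [X] a
    complex section of [V], and Cartan's formula gives
      [(X, - i flat X), (Y, - i flat Y)] |-> ([X, Y], - i (flat [X, Y] + i_Y i_X d sigma))
    for the Courant bracket. The right-hand side is again of this form exactly
    when [X, Y] lies in [V] and [i_Y i_X d sigma = 0].

    Tangent vectors being derivations of the ring of smooth functions and forms
    being known through their values on vector fields, this computation rests on
    local frames: around each point there are a smooth function [chi], vector
    fields [E_i] and 1-forms [theta_i] with [chi D = \sum_i theta_i(D) E_i] for
    every tangent vector [D] of [M]. They come from Hadamard's lemma applied to
    functions multiplied by a bump function, and they turn linearity over smooth
    functions into pointwise dependence. *)

From HB Require Import structures.
Require Import Defs.
From mathcomp Require Import all_boot all_order all_algebra.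
From mathcomp Require Import all_classical all_reals all_analysis.
From mathcomp Require Import ring lra.

Set Implicit Arguments.
Unset Strict Implicit.
Unset Printing Implicit Defensive.

Import Order.TTheory GRing.Theory Num.Theory numFieldNormedType.Exports.

Local Open Scope classical_set_scope.
Local Open Scope ring_scope.

(** * Fréchet differentiability from continuous partial derivatives *)

(** Tangent vectors act on global functions only, so coordinates and partial derivatives of a chart
    are first multiplied by a bump function and extended by zero. Identities keep the resulting
    powers of that function, which are divided out only at a point where it does not vanish.
    Hadamard's lemma also needs the segment from the base point to stay in the domain, which the
    extension to the whole Euclidean space provides. As [Ck] speaks of iterated partial derivatives,
    changing charts first requires Fréchet differentiability and a chain rule.

    A second obstacle is the gap between sections and points. Closure under the bracket concerns
    fields that lie in [V] everywhere, while the condition on d sigma concerns fields that lie in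
    [V] at one point. A smooth projection onto [V] bridges the gap. It is built from [sharp], whose
    smoothness is also part of [Phi] being an endomorphism and comes from inverting the Gram matrix
    of sigma in a local frame of [V]. *)

Section Calculus.
Variables (R : realType) (n : nat).
Implicit Types (f g : 'rV[R]_n -> R) (x v : 'rV[R]_n) (i : 'I_n).

Lemma coord_le_norm v i : `|v 0 i| <= `|v|.
Proof.
by rewrite [leRHS]/Num.norm/= mx_normrE; exact: (le_bigmax _ (fun ij => `|v ij.1 ij.2|) (0, i)).
Qed.

Lemma rV_norm_le v (r : R) : 0 <= r -> (forall i, `|v 0 i| <= r) -> `|v| <= r.
Proof.
move=> r0 vr; rewrite /Num.norm/= mx_normrE; apply/bigmax_leP; split=> // -[j i] _ /=.
by rewrite ord1.
Qed.

Lemma is_derive_line (W : normedModType R) (f : W -> R) (x v : W) (s : R) :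
  derivable f (x + s *: v) v ->
  is_derive s 1 (fun t => f (x + t *: v)) ('D_v f (x + s *: v)).
Proof.
move=> df.
have E : (fun h : R => h^-1 *: (((fun t => f (x + t *: v)) \o shift s) (h *: 1) -
    f (x + s *: v))) =
  (fun h => h^-1 *: ((f \o shift (x + s *: v)) (h *: v) - f (x + s *: v))).
  apply/funext => h /=; congr (_ *: (f _ - _)).
  by rewrite [h *: 1]mulr1 scalerDl addrCA.
by split; rewrite /derivable /derive E.
Qed.

Lemma partial_mvt f x i (t : R) :
  (forall s, `|s| <= `|t| -> derivable f (x + s *: delta_mx 0 i) (delta_mx 0 i)) ->
  exists2 c : R, `|c| <= `|t| &
    f (x + t *: delta_mx 0 i) - f x = t * 'D_(delta_mx 0 i) f (x + c *: delta_mx 0 i).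
Proof.
move=> df; pose F (s : R) : R := f (x + s *: delta_mx 0 i).
pose dF (s : R) : R := 'D_(delta_mx 0 i) f (x + s *: delta_mx 0 i).
have dF' (s : R) : `|s| <= `|t| -> is_derive s 1 F (dF s).
  by move=> /df/is_derive_line.
have F0 : F 0 = f x by rewrite /F scale0r addr0.
have cF (s : R) : `|s| <= `|t| -> {for s, continuous F}.
  by move=> /dF'[/derivable1_diffP/differentiable_continuous].
(* The mean value theorem wants ordered end points, so the two signs of [t] are separated; only the
   bound on [|c|] survives. *)
have [t0|t0] := leP 0 t.
  have in0t s : s \in `[0, t]%R -> `|s| <= `|t|.
    by rewrite in_itv/= => /andP[s0 st]; rewrite !ger0_norm.
  have [||c /in0t ct E] := @MVT_segment _ F dF 0 t t0.
  - by move=> s s0t; apply/dF'/in0t; exact: subset_itv_oo_cc s0t.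
  - by apply: continuous_in_subspaceT => s /set_mem /= /in0t/cF.
  - by exists c => //; rewrite -F0 -/(F t) E subr0 mulrC.
have in0t s : s \in `[t, 0]%R -> `|s| <= `|t|.
  by rewrite in_itv/= => /andP[s0 st]; rewrite (ltr0_norm t0) ler0_norm// lerN2.
have [||c /in0t ct E] := @MVT_segment _ F dF t 0 (ltW t0).
- by move=> s s0t; apply/dF'/in0t; exact: subset_itv_oo_cc s0t.
- by apply: continuous_in_subspaceT => s /set_mem /= /in0t/cF.
- exists c => //; rewrite -F0 -/(F t) -opprB E -/(dF c); ring.
Qed.

(** Go from [x] to [x + v] along a staircase of [n] edges parallel to the axes and use the mean
    value theorem on each edge. In the sup norm no point of the staircase is farther than [|v|] from
    [x]. *)
Lemma partials_remainder f x (r e : R) : 0 <= e ->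
  (forall y i, `|y - x| <= r -> derivable f y (delta_mx 0 i)) ->
  (forall y i, `|y - x| <= r ->
     `|'D_(delta_mx 0 i) f y - 'D_(delta_mx 0 i) f x| <= e) ->
  forall v, `|v| <= r ->
  `|f (x + v) - f x - \sum_i v 0 i * 'D_(delta_mx 0 i) f x| <= n%:R * e * `|v|.
Proof.
move=> e0 df De v vr.
pose P k : 'rV[R]_n := \row_j (if (j < k)%N then v 0 j else 0).
have P0 : P 0%N = 0 by apply/rowP => j; rewrite !mxE.
have Pn : P n = v by apply/rowP => j; rewrite !mxE ltn_ord.
have PS (i : 'I_n) : P i.+1 = P i + v 0 i *: delta_mx 0 i.
  apply/rowP => j; rewrite !mxE eqxx/= eq_sym ltnS leq_eqVlt.
  case: eqVneq => [/val_inj ->|ij]; first by rewrite eqxx/= ltnn mulr1 add0r.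
  by rewrite (negbTE (_ : i != j)) ?mulr0 ?addr0//; apply: contraNneq ij => ->.
have Pr (i : 'I_n) c : `|c| <= `|v 0 i| -> `|P i + c *: delta_mx 0 i| <= `|v|.
  move=> cv; apply: rV_norm_le => // j; rewrite !mxE eqxx/=.
  have [->|ji] := eqVneq j i.
    by rewrite ltnn mulr1 add0r (le_trans cv)// coord_le_norm.
  by rewrite mulr0 addr0; case: ifP; rewrite ?normr0// coord_le_norm.
have -> : f (x + v) - f x = \sum_(i < n) (f (x + P i.+1) - f (x + P i)).
  rewrite -(big_mkord xpredT (fun k : nat => f (x + P k.+1) - f (x + P k))).
  by rewrite telescope_sumr// Pn P0 addr0.
rewrite -sumrB (le_trans (ler_norm_sum _ _ _))//.
have -> : n%:R * e * `|v| = \sum_(i < n) e * `|v|.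
  by rewrite sumr_const card_ord -[in RHS]mulr_natl mulrA.
apply: ler_sum => i _; rewrite PS addrA.
have near c : `|c| <= `|v 0 i| -> `|x + P i + c *: delta_mx 0 i - x| <= r.
  by move=> /Pr Pv; rewrite -[x + P i + _]addrA addrAC subrr add0r (le_trans Pv).
have [|c /near cv ->] := @partial_mvt f (x + P i) i (v 0 i).
  by move=> s /near; exact: df.
rewrite -mulrBr normrM mulrC ler_pM//; first exact: De.
exact: coord_le_norm.
Qed.

Lemma differentiable_C1 f x :
  (forall i, \forall y \near x, derivable f y (delta_mx 0 i)) ->
  (forall i, {for x, continuous ('D_(delta_mx 0 i) f)}) ->
  differentiable f x.
Proof.
move=> df cf.
have dlin : linear (fun v => \sum_i v 0 i * 'D_(delta_mx 0 i) f x).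
  move=> a u v; rewrite scaler_sumr -big_split/=; apply: eq_bigr => i _.
  by rewrite !mxE mulrDl scalerAl.
pose L : {linear 'rV[R]_n -> R} := HB.pack (fun v => \sum_i v 0 i * 'D_(delta_mx 0 i) f x)
  (GRing.isLinear.Build _ _ _ _ _ dlin).
have cL : continuous (L : 'rV[R]_n -> R).
  apply: continuous_big => [|i _ v]; first exact: add_continuous.
  have ci : {for v, continuous (fun w : 'rV[R]_n => w 0 i)} by exact: coord_continuous.
  exact: cvgM ci (cvg_cst _).
have E : f \o shift x = cst (f x) + L +o_ (0 : 'rV[R]_n) id.
  apply/eqaddoP => e e0.
  (* [partials_remainder] costs a factor [n]; dividing by [n.+1] absorbs it and is safe for
     [n = 0]. *)
  have e'0 : 0 < e / (n.+1)%:R by rewrite divr_gt0.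
  have [r r0 H] : exists2 r : R, 0 < r & forall y i, `|y - x| <= r ->
      derivable f y (delta_mx 0 i) /\
      `|'D_(delta_mx 0 i) f y - 'D_(delta_mx 0 i) f x| <= e / (n.+1)%:R.
    have : \forall y \near x, forall i, derivable f y (delta_mx 0 i) /\
      `|'D_(delta_mx 0 i) f y - 'D_(delta_mx 0 i) f x| <= e / (n.+1)%:R.
      apply: (@filter_forall _ _ (fun i y => derivable f y (delta_mx 0 i) /\
        `|'D_(delta_mx 0 i) f y - 'D_(delta_mx 0 i) f x| <= e / (n.+1)%:R) (nbhs x)) => i.
      apply: (filterI (df i)).
      by have /cvgrPdistC_le := cf i; exact.
    move=> /nbhs_ballP[r /= r0 H]; exists (r / 2); first by rewrite divr_gt0.
    move=> y i yx; apply: H; rewrite -ball_normE/= distrC (le_lt_trans yx)//.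
    by rewrite ltr_pdivrMr// ltr_pMr// ltr1n.
  have Hr : \forall v \near (0 : 'rV[R]_n), `|v| <= r by exact: nbhs0_le.
  near=> v.
  rewrite /= -![(_ + _ : _ -> _) _]/(_ + _) -![(- _ : _ -> _) _]/(- _) /=
    opprD addrA addrC addrA (addrC _ (f (v + x))) (addrC v).
  rewrite (_ : f (x + v) + _ - _ = f (x + v) - f x - L v); last by rewrite /=; ring.
  have vr : `|v| <= r by near: v; exact: Hr.
  apply: (le_trans (partials_remainder (ltW e'0) (fun y i yr => (H y i yr).1)
    (fun y i yr => (H y i yr).2) vr)).
  rewrite ler_wpM2r// mulrCA ler_piMr ?(ltW e0)// ler_pdivrMr// mul1r ler_nat//.
have dE : 'd f x = L :> (_ -> _) by exact: diff_unique.
by apply/diff_locallyP; rewrite dE.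
Unshelve. all: by end_near. Qed.

Lemma diff_partials f x v : differentiable f x ->
  'd f x v = \sum_i v 0 i * 'D_(delta_mx 0 i) f x.
Proof.
move=> df; rewrite {1}(row_sum_delta v) linear_sum; apply: eq_bigr => i _.
by rewrite linearZ/= deriveE.
Qed.

(** Since [h] is only derivable along [w], the Fréchet chain rule is applied to its restriction [k]
    to the line through [y]: in one variable, derivable and differentiable agree. *)
Lemma is_derive_comp_rV (W : normedModType R) (h : W -> 'rV[R]_n) f (y w : W) :
  differentiable f (h y) -> (forall i, derivable (fun z => h z 0 i) y w) ->
  is_derive y w (f \o h)
    (\sum_i 'D_w (fun z => h z 0 i) y * 'D_(delta_mx 0 i) f (h y)).
Proof.
move=> df dh.
have dh' : derivable h y w by apply/derivable_mxP => j i; rewrite ord1.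
pose k (s : R) := h (y + s *: w).
have kh : is_derive (0 : R) 1 k ('D_w h y).
  have E : (fun s : R => s^-1 *: ((k \o shift 0) (s *: 1) - k 0)) =
    (fun s => s^-1 *: ((h \o shift y) (s *: w) - h y)).
    by apply/funext => s; rewrite /= /k !addr0 scale0r addr0 [s *: 1]mulr1 [s *: w + y]addrC.
  by split; rewrite /derivable /derive E.
have k0 : k 0 = h y by rewrite /k scale0r addr0.
have dk : differentiable k 0 by apply/derivable1_diffP; exact: ex_derive.
have dfk : differentiable f (k 0) by rewrite k0.
have dfk' : differentiable (f \o k) 0 by exact: differentiable_comp.
have E : (fun s : R => s^-1 *: (((f \o k) \o shift 0) (s *: 1) - (f \o k) 0)) =
    (fun s => s^-1 *: (((f \o h) \o shift y) (s *: w) - (f \o h) y)).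
  by apply/funext => s; rewrite /= /k !addr0 scale0r addr0 [s *: 1]mulr1 [s *: w + y]addrC.
have Dk : 'd k 0 1 = 'D_w h y by rewrite -deriveE//; exact: derive_val.
split; first by have := diff_derivable (v := 1 : R) dfk'; rewrite /derivable E.
rewrite [LHS](_ : _ = 'D_(1 : R) (f \o k) 0); last by rewrite /derive E.
rewrite deriveE// diff_comp//= k0 Dk diff_partials//.
by apply: eq_bigr => i _; rewrite derive_mx// mxE.
Qed.

End Calculus.

(** * The classes Ck *)

Section CkTheory.
Variables (R : realType).

Lemma is_derive_comp1 (W : normedModType R) (phi : R -> R) (h : W -> R) (y w : W) (d : R) :
  is_derive (h y) 1 phi d -> derivable h y w ->
  is_derive y w (phi \o h) (d * 'D_w h y).
Proof.
move=> dphi dh; have h0 : h (y + 0 *: w) = h y by rewrite scale0r addr0.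
have := @is_derive_line _ _ h y w 0; rewrite scale0r addr0 => /(_ dh) dk.
have dphi' : is_derive (h (y + 0 *: w)) 1 phi d by rewrite h0.
have := @is_derive1_comp _ phi (fun t => h (y + t *: w)) 0 _ _ dphi' dk.
set k := _ \o _; move=> [dc Dc].
have E : (fun s : R => s^-1 *: ((k \o shift 0) (s *: 1) - k 0)) =
    (fun s => s^-1 *: (((phi \o h) \o shift y) (s *: w) - (phi \o h) y)).
  by apply/funext => s; rewrite /= /k/= !addr0 scale0r addr0 [s *: 1]mulr1 [s *: w + y]addrC.
by split; [move: dc; rewrite /derivable E|move: Dc; rewrite /derive E => ->; rewrite mulrC].
Qed.

Variable n : nat.
Implicit Types (U W : set 'rV[R]_n) (f g : 'rV[R]_n -> R) (k : nat).

Lemma Ck_sub U W f k : W `<=` U -> Ck k U f -> Ck k W f.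
Proof.
move=> WU; elim: k f => [|k IH] f [cf df]; split=> //; try by move=> x /WU/cf.
by move=> i; have [di Di] := df i; split=> [x /WU/di//|]; exact: IH.
Qed.

Lemma Ck_local U f k :
  (forall x, U x -> exists W, [/\ open W, W x & Ck k W f]) -> Ck k U f.
Proof.
elim: k f => [|k IH] f loc.
  by split=> // x /loc[W [_ Wx [cf _]]]; exact: cf.
split=> [x /loc[W [_ Wx [cf _]]]|i]; first exact: cf.
split=> [x /loc[W [_ Wx [_ df]]]|]; first exact: (df i).1.
by apply: IH => x /loc[W [oW Wx [_ df]]]; exists W; split=> //; exact: (df i).2.
Qed.

Lemma Ck_derivable U f k x i : Ck k.+1 U f -> U x -> derivable f x (delta_mx 0 i).
Proof. by move=> [_ df]; exact: (df i).1. Qed.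

Lemma Ck_continuous U f k x : Ck k U f -> U x -> {for x, continuous f}.
Proof. by case: k => [|k] [cf _]; exact: cf. Qed.

Lemma Ck_differentiable U f k x : open U -> Ck k.+1 U f -> U x -> differentiable f x.
Proof.
move=> oU [_ df] Ux; apply: differentiable_C1 => i; last first.
  exact: Ck_continuous (df i).2 Ux.
by apply: filterS (open_nbhs_nbhs (conj oU Ux)) => y /(df i).1.
Qed.

Lemma is_derive_coord (x v : 'rV[R]_n) (i : 'I_n) :
  is_derive x v (fun y : 'rV[R]_n => y 0 i) (v 0 i).
Proof.
have dx : derivable (fun y : 'rV[R]_n => y) x v by exact: derivable_id.
split; first by move/derivable_mxP : dx; exact.
by have := derive_mx dx; rewrite derive_id => /matrixP/(_ 0 i); rewrite mxE => ->.
Qed.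

Lemma Ck_coord U k (i : 'I_n) : open U -> Ck k U (fun x : 'rV[R]_n => x 0 i).
Proof.
move=> oU; have cx (x : 'rV[R]_n) : {for x, continuous (fun y : 'rV[R]_n => y 0 i)}.
  exact: coord_continuous.
case: k => [|k]; split=> // j; split=> [x _|].
  by have [] := is_derive_coord x (delta_mx 0 j) i.
apply: Ck_ext (Ck_cst ((delta_mx 0 j : 'rV[R]_n) 0 i) k oU) => // x Ux.
by have [_ ->] := is_derive_coord x (delta_mx 0 j) i.
Qed.

Lemma Ck_sum (I : Type) (r : seq I) (P : pred I) (F : I -> 'rV[R]_n -> R) U k :
  open U -> (forall i, P i -> Ck k U (F i)) ->
  Ck k U (fun x => \sum_(i <- r | P i) F i x).
Proof.
move=> oU CF; rewrite (_ : (fun x => _) = \sum_(i <- r | P i) F i); last first.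
  by apply/funext => x; rewrite fct_sumE.
by elim/big_ind : _ => //; [exact: (Ck_cst 0)|move=> f g; exact: CkD].
Qed.

Lemma CkN U f k : open U -> Ck k U f -> Ck k U (fun x => - f x).
Proof.
move=> oU Cf; apply: Ck_ext (CkM oU (Ck_cst (-1) k oU) Cf) => // x Ux.
by change (-1 * f x = - f x); rewrite mulN1r.
Qed.

Lemma CkV U f k : open U -> (forall x, U x -> f x != 0) -> Ck k U f ->
  Ck k U (fun x => (f x)^-1).
Proof.
move=> oU f0; elim: k => [|k IH] Cf.
  by split=> // x Ux; exact: (cvgV (f0 _ Ux) (Ck_continuous Cf Ux)).
split=> [x Ux|i].
  by exact: (cvgV (f0 _ Ux) (Ck_continuous Cf Ux)).
split=> [x Ux|]; first exact: derivableV (f0 _ Ux) (Ck_derivable Cf Ux).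
have CV := IH (CkW Cf).
apply: Ck_ext (CkN oU (CkM oU (CkM oU CV CV) (Cf.2 i).2)) => // x Ux.
rewrite deriveV; [|exact: f0|exact: Ck_derivable Cf Ux].
change (- ((f x)^-1 * (f x)^-1 * 'D_(delta_mx 0 i) f x) =
  - (f x) ^- 2 * 'D_(delta_mx 0 i) f x).
by rewrite -exprVn expr2; ring.
Qed.

Lemma rV_continuous (T : topologicalType) (h : T -> 'rV[R]_n) x :
  (forall i, {for x, continuous (fun y => h y 0 i)}) -> {for x, continuous h}.
Proof.
move=> ch; apply/cvgrPdist_le => e e0.
have : \forall y \near x, forall i, `|h x 0 i - h y 0 i| <= e.
  apply: (@filter_forall _ _ (fun i y => `|h x 0 i - h y 0 i| <= e) (nbhs x)) => i.
  by have /cvgrPdist_le := ch i; exact.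
apply: filterS => y H; apply: rV_norm_le (ltW e0) _ => i.
by rewrite !mxE.
Qed.

End CkTheory.

Lemma Ck_comp (R : realType) (m n : nat) (U : set 'rV[R]_m) (W : set 'rV[R]_n)
    (h : 'rV[R]_m -> 'rV[R]_n) (f : 'rV[R]_n -> R) k :
  open U -> open W -> (forall x, U x -> W (h x)) ->
  (forall i, Ck k U (fun x => h x 0 i)) -> Ck k W f -> Ck k U (f \o h).
Proof.
move=> oU oW UW; elim: k f => [|k IH] f Ch Cf.
  split=> // x Ux; apply: continuous_comp; last exact: Ck_continuous Cf (UW _ Ux).
  by apply: rV_continuous => i; exact: Ck_continuous (Ch i) Ux.
have dfh x j : U x -> is_derive x (delta_mx 0 j) (f \o h)
    (\sum_i 'D_(delta_mx 0 j) (fun z => h z 0 i) x * 'D_(delta_mx 0 i) f (h x)).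
  move=> Ux; apply: is_derive_comp_rV; first exact: Ck_differentiable oW Cf (UW _ Ux).
  by move=> i; exact: Ck_derivable (Ch i) Ux.
split=> [x Ux|j].
  apply: continuous_comp; last exact: Ck_continuous Cf (UW _ Ux).
  by apply: rV_continuous => i; exact: Ck_continuous (Ch i) Ux.
split=> [x /(dfh x j)[]//|].
apply: Ck_ext; first exact: oU.
  by move=> x /(dfh x j)[_ ->]; reflexivity.
apply: Ck_sum => // i _.
apply: (CkM oU ((Ch i).2 j).2 (IH _ _ (Cf.2 i).2)) => {}i.
exact: CkW (Ch i).
Qed.

(** * Hadamard's lemma *)

Section Hadamard.
Variables (R : realType) (n : nat).
Notation mu := (@lebesgue_measure R).
Implicit Types (h : 'rV[R]_n -> R) (a x y z v : 'rV[R]_n) (m k : nat) (i : 'I_n).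

Lemma integrable01 (f : R -> R) : continuous f -> mu.-integrable `[0, 1] (EFin \o f).
Proof.
move=> cf; apply: continuous_compact_integrable; first exact: segment_compact.
exact: continuous_subspaceT.
Qed.

(** For [m = 0] and a partial derivative [h], this is the coefficient in Hadamard's lemma. The
    weight [t ^+ m] closes the family under partial derivatives, each of which brings out one more
    factor [t]. *)
Definition segint a m h x : R :=
  \int[mu]_(t in `[0, 1]) (t ^+ m * h (a + t *: (x - a))).

Definition smoothE h := forall k, Ck k setT h.

Lemma smoothE_partial h i : smoothE h -> smoothE ('D_(delta_mx 0 i) h).
Proof. by move=> sh k; exact: ((sh k.+1).2 i).2. Qed.

Lemma smoothE_continuous h : smoothE h -> continuous h.
Proof. by move=> sh x; exact: Ck_continuous (sh 0%N) _. Qed.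

Lemma smoothE_differentiable h x : smoothE h -> differentiable h x.
Proof. by move=> sh; exact: Ck_differentiable openT (sh 1%N) _. Qed.

Lemma continuous_line (h : 'rV[R]_n -> R) x v :
  continuous h -> continuous (fun t : R => h (x + t *: v)).
Proof.
move=> ch t; apply: continuous_comp; last exact: ch.
by apply: cvgD; [exact: cvg_cst|apply: cvgZ; [exact: cvg_id|exact: cvg_cst]].
Qed.

Lemma continuous_segint_integrand a m h x :
  continuous h -> continuous (fun t : R => t ^+ m * h (a + t *: (x - a))).
Proof.
by move=> ch t; apply: cvgM; [exact: exprn_continuous|exact: continuous_line].
Qed.

Lemma compact_norm_ball a (r : R) : compact [set y | `|y - a| <= r].
Proof.
apply: bounded_closed_compact.
  exists (`|a| + r); split; first by rewrite num_real.
  move=> M rM y /= yr; rewrite -(subrK a y) (le_trans (ler_normD _ _))//.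
  by rewrite addrC (le_trans _ (ltW rM))// lerD2l.
rewrite (_ : mkset _ = (fun y : 'rV[R]_n => `|y - a|) @^-1` [set z | z <= r])//.
apply: closed_comp; last exact: closed_le.
move=> y _; pose g z : 'rV[R]_n := z - a.
have cg : {for y, continuous g}.
  exact: (@cvgB _ _ _ (nbhs y) _ id (cst a) y a (@cvg_id _ _) (cvg_cst _)).
exact: (cvg_norm cg).
Qed.

Lemma continuous_bounded_ball h a (r : R) : continuous h ->
  exists2 C : R, 0 <= C & forall y, `|y - a| <= r -> `|h y| <= C.
Proof.
move=> ch; have cA := @compact_norm_ball a r.
have /compact_bounded[M [_ HM]] : compact (h @` [set y | `|y - a| <= r]).
  by apply: continuous_compact => //; exact: continuous_subspaceT.
exists (`|M| + 1) => [|y yr]; first by rewrite addr_ge0.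
apply: HM; first by rewrite (le_lt_trans (ler_norm _))// ltrDl.
by exists y.
Qed.

Lemma segint_bounded a m h (r : R) : continuous h ->
  exists2 C : R, 0 <= C & forall y, `|y - a| <= r -> `|segint a m h y| <= C.
Proof.
move=> ch; have [C C0 hC] := continuous_bounded_ball a r ch; exists C => // y yr.
have ci := @continuous_segint_integrand a m h y ch.
apply: (le_trans (le_normr_Rintegral _ _)) => //; first exact: integrable01.
have -> : C = \int[mu]_(t in `[0, 1]) C.
  by rewrite Rintegral_cst//= lebesgue_measure_itv/= lte_fin ltr01 oppr0 adde0 mulr1.
apply: le_Rintegral => //.
- by apply: integrable01 => t; exact: cvg_norm (ci t).
- by apply: integrable01 => t; exact: cvg_cst.
- move=> t /=; rewrite in_itv/= => /andP[t0 t1].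
  rewrite normrM -[leRHS]mul1r ler_pM//.
    by rewrite normrX exprn_ile1// ger0_norm.
  apply: hC; rewrite addrC addKr normrZ (le_trans _ yr)//.
  by rewrite ler_piMl// ger0_norm.
Qed.

Lemma is_derive_segint a m h x i : smoothE h ->
  is_derive x (delta_mx 0 i) (segint a m h)
    (segint a m.+1 ('D_(delta_mx 0 i) h) x).
Proof.
move=> sh; pose v : 'rV[R]_n := delta_mx 0 i.
have sdh := smoothE_partial i sh.
pose f (s t : R) : R := t ^+ m * h (a + t *: (x + s *: v - a)).
pose df (s t : R) : R := t ^+ m.+1 * 'D_v h (a + t *: (x + s *: v - a)).
have fE (s t : R) : a + t *: (x + s *: v - a) = a + t *: (x - a) + (s * t) *: v.
  by rewrite [x + _ - a]addrAC scalerDr scalerA addrA [t * s]mulrC.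
have ff (s t : R) : is_derive s 1 (f ^~ t) (df s t).
  pose H (u : R) : R := h (a + t *: (x - a) + u *: v).
  have dH : is_derive (s * t) 1 H ('D_v h (a + t *: (x - a) + (s * t) *: v)).
    by apply: is_derive_line; exact: diff_derivable (smoothE_differentiable _ sh).
  have -> : f ^~ t = (t ^+ m) *: (H \o ( *%R^~ t)).
    by apply/funext => s'; rewrite /f fE.
  have dst : is_derive s 1 ( *%R^~ t : R -> R) t.
    have -> : *%R^~ t = t *: id :> (R -> R) by apply/funext => s'; exact: mulrC.
    by apply: (is_derive_eq (is_deriveZ t (is_derive_id s 1))); exact: mulr1.
  have D1 := @is_derive1_comp _ H ( *%R^~ t) s _ _ dH dst.
  have D2 := @is_deriveZ _ _ _ _ (t ^+ m) s 1 _ D1.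
  apply: (is_derive_eq D2).
  by rewrite /df fE [RHS]mulrC exprS -[LHS]/(t ^+ m * _); ring.
have cdf (s : R) : continuous (df s).
  exact: continuous_segint_integrand (smoothE_continuous sdh).
have fi (s : R) : mu.-integrable `[0, 1] (EFin \o f s).
  by apply: integrable01; exact: continuous_segint_integrand (smoothE_continuous sh).
(* For [|s| < 1] and [t] in [[0, 1]] the argument of the partial derivative stays in this ball
   around [a], so that a constant dominates the differentiated integrand. *)
have [C C0 hC] := continuous_bounded_ball a (`|x - a| + `|v|) (smoothE_continuous sdh).
have dC (s t : R) : `]-1, 1[%classic s -> `[0, 1]%classic t -> `|partial1of2 f s t| <= C.
  rewrite /= !in_itv/= -ltr_norml => s1 /andP[t0 t1].
  rewrite partial1of2E (@derive_val _ _ _ _ _ _ _ (ff s t)) normrM.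
  rewrite -[leRHS]mul1r ler_pM//.
    by rewrite normrX exprn_ile1// ger0_norm.
  apply: hC; rewrite addrC addKr normrZ.
  rewrite (@le_trans _ _ `|x + s *: v - a|)//; first by rewrite ler_piMl// ger0_norm.
  rewrite addrAC (le_trans (ler_normD _ _))// lerD2l normrZ ler_piMl//.
  exact: ltW.
have I0 : `]-1, 1[%classic (0 : R) by rewrite /= in_itv/= ltrN10 ltr01.
have Cint : mu.-integrable `[0, 1] (EFin \o cst C).
  by apply: integrable01 => t; exact: cvg_cst.
have fD (s t : R) : `]-1, 1[%classic s -> `[0, 1]%classic t -> derivable (f ^~ t) s 1.
  by move=> _ _; have [] := ff s t.
have := @cvg_differentiation_under_integral _ _ _ mu f `[0, 1]%classic
  (measurable_itv _) 0 (-1) 1 I0 (fun s _ => fi s) fD (cst C) (fun=> C0) Cint dC.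
have -> : \int[mu]_(t in `[0, 1]) partial1of2 f 0 t =
    segint a m.+1 ('D_v h) x.
  apply: eq_Rintegral => t _.
  by rewrite partial1of2E (@derive_val _ _ _ _ _ _ _ (ff 0 t)) /df scale0r addr0.
have -> : (fun s : R => s^-1 *: (\int[mu]_(t in `[0, 1]) f (s + 0) t -
      \int[mu]_(t in `[0, 1]) f 0 t)) =
    (fun s => s^-1 *: ((segint a m h \o shift x) (s *: v) - segint a m h x)).
  have E0 : \int[mu]_(t in `[0, 1]) f 0 t = segint a m h x.
    by apply: eq_Rintegral => t _; rewrite /f scale0r addr0.
  have Es s : \int[mu]_(t in `[0, 1]) f (s + 0) t = segint a m h (s *: v + x).
    by apply: eq_Rintegral => t _; rewrite /f addr0 [s *: v + x]addrC.
  by apply/funext => s; rewrite E0 Es.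
move=> D; split; first by apply/cvg_ex; exists (segint a m.+1 ('D_v h) x).
exact: cvg_lim D.
Qed.

(** The partial derivatives exist everywhere and are again of the form [segint], hence bounded near
    [x]; [partials_remainder] turns this into a Lipschitz estimate at [x]. *)
Lemma continuous_segint a m h : smoothE h -> continuous (segint a m h).
Proof.
move=> sh x.
pose D i := segint a m.+1 ('D_(delta_mx 0 i) h).
have dE y i : 'D_(delta_mx 0 i) (segint a m h) y = D i y.
  by have [] := is_derive_segint a m y i sh.
have [C C0 HC] : exists2 C : R, 0 <= C & forall y i, `|y - x| <= 1 ->
    `|D i y - D i x| <= C.
  have /choice[C HC] i : exists C : R, 0 <= C /\
      forall y, `|y - x| <= 1 -> `|D i y - D i x| <= C.
    have [C C0 HC] := segint_bounded a m.+1 (`|x - a| + 1)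
      (smoothE_continuous (smoothE_partial i sh)).
    exists (C + C); split=> [|y yx]; first exact: addr_ge0.
    rewrite (le_trans (ler_normB _ _))// lerD//; apply: HC; last by rewrite lerDl.
    by rewrite -(subrKA x) addrC (le_trans (ler_normD _ _))// lerD2l.
  exists (\sum_i C i) => [|y i yx]; first by apply: sumr_ge0 => i _; exact: (HC i).1.
  apply: (le_trans ((HC i).2 _ yx)); rewrite (bigD1 i)//= lerDl.
  by apply: sumr_ge0 => j _; exact: (HC j).1.
have rem := @partials_remainder _ _ (segint a m h) x 1 C C0.
pose K := n%:R * C + \sum_i `|D i x|.
have K0 : 0 <= K by rewrite addr_ge0// ?mulr_ge0// sumr_ge0.
have lip v : `|v| <= 1 -> `|segint a m h (x + v) - segint a m h x| <= K * `|v|.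
  move=> v1; have := rem _ _ v v1.
  have d1 y i : `|y - x| <= 1 -> derivable (segint a m h) y (delta_mx 0 i).
    by move=> _; have [] := is_derive_segint a m y i sh.
  have d2 y i : `|y - x| <= 1 -> `|'D_(delta_mx 0 i) (segint a m h) y -
      'D_(delta_mx 0 i) (segint a m h) x| <= C by rewrite !dE; exact: HC.
  move=> /(_ d1 d2) le1; rewrite -(subrK (\sum_i v 0 i * 'D_(delta_mx 0 i)
    (segint a m h) x) (_ - _)) (le_trans (ler_normD _ _))// mulrDl lerD//.
  rewrite (le_trans (ler_norm_sum _ _ _))// mulr_suml ler_sum// => i _.
  by rewrite dE normrM mulrC ler_wpM2l// coord_le_norm.
apply/(@cvgrPdistC_le _ _ _ (nbhs x)) => e e0.
have K1 : 0 < K + 1 by rewrite ltr_wpDl.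
have : \forall y \near x, `|y - x| <= Num.min 1 (e / (K + 1)).
  have r0 : 0 < Num.min 1 (e / (K + 1)) by rewrite lt_min ltr01 divr_gt0.
  apply/nbhs_ballP; exists (Num.min 1 (e / (K + 1))) => //= y.
  by rewrite -ball_normE/= distrC => /ltW.
apply: filterS => y; rewrite le_min => /andP[y1 ye].
have := lip _ y1; rewrite [x + _]addrC subrK => /le_trans; apply.
rewrite (@le_trans _ _ ((K + 1) * (e / (K + 1))))//.
  by rewrite ler_pM// lerDl.
by rewrite mulrCA divff ?mulr1// gt_eqF.
Qed.

Lemma smoothE_segint a m h : smoothE h -> smoothE (segint a m h).
Proof.
move=> sh k; elim: k m h sh => [|k IH] m h sh.
  by split=> // x _; exact: continuous_segint.
split=> [x _|i]; first exact: continuous_segint.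
split=> [x _|]; first by have [] := is_derive_segint a m x i sh.
apply: Ck_ext (IH m.+1 _ (smoothE_partial i sh)); first exact: openT.
by move=> x _; have [_ ->] := is_derive_segint a m x i sh.
Qed.

Lemma segint_center h a : segint a 0 h a = h a.
Proof.
rewrite /segint (@eq_Rintegral _ _ _ _ _ (cst (h a))).
  by rewrite Rintegral_cst//= lebesgue_measure_itv/= lte_fin ltr01 oppr0 adde0 mulr1.
by move=> t _; rewrite expr0 mul1r subrr scaler0 addr0.
Qed.

(** The fundamental theorem of calculus along the segment from [a] to [x], the derivative being
    expanded in partial derivatives. *)
Lemma hadamard h a x : smoothE h ->
  h x = h a + \sum_i (x 0 i - a 0 i) * segint a 0 ('D_(delta_mx 0 i) h) x.
Proof.
move=> sh; pose G (t : R) : R := h (a + t *: (x - a)).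
pose g i (t : R) : R := t ^+ 0 * 'D_(delta_mx 0 i) h (a + t *: (x - a)).
pose dG (t : R) : R := \sum_i (x 0 i - a 0 i) * g i t.
have cg i : continuous (g i).
  exact: continuous_segint_integrand (smoothE_continuous (smoothE_partial i sh)).
have cxg i : continuous (fun t => (x 0 i - a 0 i) * g i t).
  by move=> t; apply: cvgM; [exact: cvg_cst|exact: cg].
have dGE (t : R) : is_derive t 1 G (dG t).
  have dh := smoothE_differentiable (a + t *: (x - a)) sh.
  apply: is_derive_eq (is_derive_line (diff_derivable dh)) _.
  rewrite deriveE// diff_partials//; apply: eq_bigr => i _.
  by rewrite !mxE /g expr0 mul1r.
have cdG : continuous dG.
  by apply: continuous_big => [|i _]; [exact: add_continuous|exact: cxg].
have cG : continuous G by exact: continuous_line (smoothE_continuous sh).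
have FTC : \int[mu]_(t in `[0, 1]) dG t = G 1 - G 0.
  rewrite /Rintegral (@continuous_FTC2 _ dG G)//; first exact: continuous_subspaceT.
    split; first by move=> t _; have [] := dGE t.
      by apply: cvg_at_right_filter; exact: cG.
    by apply: cvg_at_left_filter; exact: cG.
  by move=> t _; rewrite derive1E derive_val.
have G1 : G 1 = h x by rewrite /G scale1r addrC subrK.
have G0 : G 0 = h a by rewrite /G scale0r addr0.
rewrite -G1 -G0 -[LHS](subrK (G 0)) addrC; congr (_ + _).
rewrite -FTC /Rintegral; under eq_integral do rewrite /dG -sumEFin.
rewrite integral_sum//; last by move=> i; exact: integrable01.
rewrite -sum_fine; last first.
  by move=> i _; apply: integrable_fin_num => //; exact: integrable01.
by apply: eq_bigr => i _; rewrite -[LHS]/(Rintegral _ _ _) RintegralZl//; exact: integrable01.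
Qed.

End Hadamard.

(** * Bump functions *)

Section Bump.
Variable R : realType.
Implicit Types (m : nat) (t : R).

(* The derivatives of [exp (- 1 / t)] are combinations of the members of this
   family, which is closed under differentiation. *)
Definition flat_exp m t : R := if 0 < t then t^-1 ^+ m * expR (- t^-1) else 0.

Lemma flat_exp_ge0 m t : 0 <= flat_exp m t.
Proof.
rewrite /flat_exp; case: ifPn => // t0.
by rewrite mulr_ge0// ?expR_ge0// exprn_ge0// invr_ge0 ltW.
Qed.

(** With [u = t^-1], the exponential of [u] dominates the term [u ^+ m.+2 / m.+2!] of its series.
    The exponent 2 makes the derivative at [0] vanish. *)
Lemma flat_exp_le m t : 0 < t -> flat_exp m t <= m.+2`!%:R * t ^+ 2.
Proof.
move=> t0; rewrite /flat_exp t0 -[leLHS](divfK (_ : t ^+ 2 != 0)); last first.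
  by rewrite expf_neq0// gt_eqF.
rewrite ler_wpM2r ?sqr_ge0// -exprVn mulrAC -exprD addn2.
have u0 : 0 <= t^-1 by rewrite invr_ge0 ltW.
have := expR_ge1Dxn m.+1 u0.
rewrite expRN ler_pdivrMr ?expR_gt0// => /(le_trans _) -/(_ (t^-1 ^+ m.+2 / m.+2`!%:R)).
by rewrite lerDr ler01 ler_pdivrMr ?ltr0n ?fact_gt0// mulrC; exact.
Qed.

Lemma is_derive_flat_exp m t :
  is_derive t 1 (flat_exp m) (flat_exp m.+2 t - m%:R * flat_exp m.+1 t).
Proof.
have [t0|t0|->] := ltgtP t 0.
- have Z m' : flat_exp m' t = 0 by rewrite /flat_exp ltNge (ltW t0).
  rewrite !Z mulr0 subr0.
  apply: (@near_eq_is_derive _ _ _ (cst (0 : R))).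
  near=> s; rewrite /flat_exp ltNge (_ : s <= 0)//.
  by near: s; exact: (cvgr_le t).
- pose P (u : R) : R := u ^+ m * expR (- u).
  have dP (u : R) : is_derive u 1 P (m%:R * u ^+ m.-1 * expR (- u) - u ^+ m * expR (- u)).
    have D1 : is_derive u 1 (fun u : R => expR (- u)) (- expR (- u)).
      have D := @is_derive1_comp _ expR -%R u _ _ (is_derive_expR (- u)) (is_deriveNid u 1).
      by apply: (is_derive_eq D); rewrite mulrN1.
    have D2 := is_deriveX m (is_derive_id u (1 : R)).
    have D3 := is_deriveM D2 D1.
    have -> : P = (id ^+ m) * (fun u : R => expR (- u)).
      by apply/funext => w; rewrite /P mulrfctE exprfctE.
    apply: (is_derive_eq D3); rewrite -![_ *: _]/(_ * _) exprfctE; ring.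
  have dV : is_derive t 1 (fun s : R => s^-1) (- t ^- 2).
    have D := @is_deriveV _ id t 1 1 (lt0r_neq0 t0) (is_derive_id t 1).
    by apply: (is_derive_eq D); exact: mulr1.
  apply: (@near_eq_is_derive _ _ _ (P \o (fun s : R => s^-1))).
    near=> s; rewrite /flat_exp (_ : 0 < s)//.
    by near: s; exact: (cvgr_gt t).
  apply: (is_derive_eq (is_derive1_comp (dP t^-1) dV)).
  rewrite /flat_exp t0 -exprVn; case: m {P dP} => [|m] /=; rewrite ?expr0 !exprS; ring.
- have Z m' : flat_exp m' 0 = 0 by rewrite /flat_exp ltxx.
  rewrite !Z mulr0 subr0.
  (* The difference quotient at [0] is zero for negative [s] and, by the quadratic bound, at most a
     constant times [s] for positive [s]. *)
  have D : (fun s : R => s^-1 *: ((flat_exp m \o shift 0) (s *: 1) - flat_exp m 0)) s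
      @[s --> (0 : R)^'] --> (0 : R).
    apply/cvgr0Pnorm_le => e e0; near=> s.
    rewrite /= addr0 [s *: 1]mulr1 Z subr0.
    have [s0|s0] := ltP 0 s; last by rewrite /flat_exp ltNge s0/= scaler0 normr0 ltW.
    rewrite normrM normfV (gtr0_norm s0) (ger0_norm (flat_exp_ge0 m s)) ler_pdivrMl//.
    apply: (le_trans (flat_exp_le m s0)); rewrite expr2 mulrA mulrC ler_pM2l//.
    rewrite -ler_pdivlMl ?ltr0n ?fact_gt0// (le_trans (ler_norm s))//.
    near: s; apply: dnbhs0_le; rewrite mulr_gt0// invr_gt0 ltr0n fact_gt0//.
  by split; [apply/cvg_ex; exists 0|exact: cvg_lim D].
Unshelve. all: by end_near. Qed.

Variable n : nat.

Lemma Ck_flat_exp (U : set 'rV[R]_n) (h : 'rV[R]_n -> R) m k :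
  open U -> Ck k U h -> Ck k U (flat_exp m \o h).
Proof.
move=> oU; have cflat m' : continuous (flat_exp m').
  move=> t; apply: differentiable_continuous; apply/derivable1_diffP.
  by have [] := is_derive_flat_exp m' t.
have cc m' k' x : Ck k' U h -> U x -> {for x, continuous (flat_exp m' \o h)}.
  move=> Ch Ux; apply: continuous_comp; last exact: cflat.
  exact: Ck_continuous Ch Ux.
elim: k m => [|k IH] m Ch; first by split=> // x Ux; exact: cc Ch Ux.
have dh x i : U x -> is_derive x (delta_mx 0 i) (flat_exp m \o h)
    ((flat_exp m.+2 (h x) - m%:R * flat_exp m.+1 (h x)) * 'D_(delta_mx 0 i) h x).
  move=> Ux; apply: is_derive_comp1; first exact: is_derive_flat_exp.
  exact: Ck_derivable Ch Ux.
split=> [x Ux|i]; first exact: cc Ch Ux.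
split=> [x /(dh x i)[]//|].
apply: Ck_ext; first exact: oU.
  by move=> x /(dh x i)[_ ->]; reflexivity.
have Ch' := CkW Ch.
apply: (CkM oU _ (Ch.2 i).2).
apply: (CkD oU (IH m.+2 Ch')).
exact: CkN oU (CkM oU (Ck_cst m%:R k oU) (IH m.+1 Ch')).
Qed.

(** The sum of squares is smooth, unlike the sup norm; its ball of radius [r] is contained in the
    sup norm ball that serves as support. *)
Definition bump (a : 'rV[R]_n) (r : R) (x : 'rV[R]_n) : R :=
  flat_exp 0 (r ^+ 2 - \sum_i (x 0 i - a 0 i) ^+ 2).

Lemma smoothE_bump a r : smoothE (bump a r).
Proof.
move=> k; apply: (Ck_flat_exp _ openT); apply: (CkD openT (Ck_cst _ _ openT)).
apply: CkN; first exact: openT.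
apply: Ck_sum => [|i _]; first exact: openT.
have C : Ck k setT (fun x : 'rV[R]_n => x 0 i - a 0 i).
  exact: (CkD openT (Ck_coord _ _ openT) (Ck_cst (- a 0 i) _ openT)).
exact: (CkM openT C C).
Qed.

Lemma bump_center a (r : R) : 0 < r -> bump a r a != 0.
Proof.
move=> r0; rewrite /bump big1 ?subr0 => [|i _]; last by rewrite subrr expr0n.
by rewrite /flat_exp exprn_gt0// expr0 mul1r gt_eqF// expR_gt0.
Qed.

Lemma bump_support a (r : R) x : 0 < r -> bump a r x != 0 -> `|x - a| <= r.
Proof.
rewrite /bump /flat_exp => r0; case: ifPn; rewrite ?eqxx// subr_gt0 => xr _.
apply: rV_norm_le (ltW r0) _ => i; rewrite !mxE.
rewrite -(@ler_pXn2r _ 2) ?nnegrE ?normr_ge0 ?(ltW r0)//.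
rewrite real_normK ?num_real// (le_trans _ (ltW xr))// (bigD1 i)//= lerDl.
by apply: sumr_ge0 => j _; exact: sqr_ge0.
Qed.

End Bump.

(** * Localization on manifolds *)

Section SmoothE.
Variables (R : realType) (n : nat).

Lemma smoothE_patch (U K : set 'rV[R]_n) (G : 'rV[R]_n -> R) :
  open U -> closed K -> K `<=` U -> smooth_on U G ->
  (forall x, U x -> ~ K x -> G x = 0) -> smoothE (G \_ U).
Proof.
move=> oU cK KU sG G0 k; apply: Ck_local => x _.
have [Ux|nUx] := pselect (U x).
  exists U; split=> //; apply: Ck_ext (sG k) => // y Uy.
  by rewrite patchE mem_set.
exists (~` K); split; [exact: closed_openC|by move=> /KU|].
apply: Ck_ext (Ck_cst 0 k (closed_openC cK)); first exact: closed_openC.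
move=> y nKy; rewrite patchE; case: ifPn => // /set_mem Uy.
by rewrite G0.
Qed.

End SmoothE.

Section ManifoldSmooth.
Variables (R : realType) (n : nat) (M : manifold R n).
Implicit Types (f g : M -> R) (W : set M) (c : chart R n M).

Lemma open_chart_image c W : open W -> open (cmap c @` (cdom c `&` W)).
Proof.
move=> oW; rewrite openE => _ [q [cq Wq] <-]; rewrite /interior.
have cx : (cmap c @` cdom c) (cmap c q) by exists q.
have := open_nbhs_nbhs (conj (@cimg_open _ _ _ c) cx).
have nW : nbhs (cinv c (cmap c q)) W by rewrite cmapK//; exact: open_nbhs_nbhs.
have := cinv_cont cx nW; rewrite nbhs_filterE => H1 H2.
apply: (@filterS2 _ (nbhs (cmap c q)) _ _ _ _ _ H1 H2) => y Wy [z cz zy].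
by exists z => //; split=> //; move: Wy; rewrite /= -zy cmapK.
Qed.

Definition smooth_in W f : Prop := forall c, atlas c ->
  smooth_on (cmap c @` (cdom c `&` W)) (f \o cinv c).

Lemma smooth_local f :
  (forall p, exists W, [/\ open W, W p & smooth_in W f]) -> smooth f.
Proof.
move=> loc c Mc k; apply: Ck_local => _ [q cq <-].
have [W [oW Wq sf]] := loc q.
exists (cmap c @` (cdom c `&` W)); split; last exact: sf.
  exact: open_chart_image.
by exists q.
Qed.

Lemma smooth_in_ext W f g : open W -> (forall q, W q -> f q = g q) ->
  smooth_in W f -> smooth_in W g.
Proof.
move=> oW fg sf c Mc k; apply: Ck_ext (sf c Mc k); first exact: open_chart_image.
by move=> _ [q [cq Wq] <-] /=; rewrite cmapK// fg.
Qed.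

Lemma smooth_inW W f : smooth f -> smooth_in W f.
Proof.
by move=> sf c Mc k; apply: Ck_sub (sf c Mc k) => _ [q [cq _] <-]; exists q.
Qed.

(** Shaped for Cramer's rule: numerator and determinant are global smooth functions, the quotient is
    controlled on [W] only. *)
Lemma smooth_div f (h d : M -> R) :
  smooth h -> smooth d -> forall W, open W -> (forall q, W q -> d q != 0) ->
  (forall q, W q -> d q * f q = h q) -> smooth_in W f.
Proof.
move=> sh sd W oW d0 dfh.
apply: (@smooth_in_ext _ (fun q => h q * (d q)^-1)) => // [q Wq|].
  by rewrite -dfh// mulrAC divff ?mul1r// d0.
move=> c Mc k; have oc := @open_chart_image c _ oW.
apply: (@CkM _ _ _ (h \o cinv c) (fun x => (d (cinv c x))^-1) k oc).
  exact: (@smooth_inW W h sh c Mc k).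
apply: (@CkV _ _ _ (d \o cinv c)) => //; last exact: smooth_inW.
by move=> _ [q [cq Wq] <-] /=; rewrite cmapK// d0.
Qed.

Lemma smooth_in_chart c (G : 'rV[R]_n -> R) : atlas c ->
  smooth_on (cmap c @` cdom c) G -> smooth_in (cdom c) (G \o cmap c).
Proof.
move=> Mc sG c' Mc' k.
have oc := @open_chart_image c' _ (@cdom_open _ _ _ c).
apply: (@Ck_comp _ _ _ _ (cmap c @` cdom c) (cmap c \o cinv c') G) => //.
- exact: cimg_open.
- by move=> _ [q [c'q cq] <-] /=; rewrite cmapK//; exists q.
- by move=> i; exact: atlas_compat Mc' Mc i k.
Qed.

Lemma smooth_patch c (K : set 'rV[R]_n) (G : 'rV[R]_n -> R) :
  atlas c -> compact K -> K `<=` cmap c @` cdom c ->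
  smooth_on (cmap c @` cdom c) G ->
  (forall x, (cmap c @` cdom c) x -> ~ K x -> G x = 0) ->
  smooth ((G \o cmap c) \_ (cdom c)).
Proof.
move=> Mc cK KU sG G0; apply: smooth_local => p.
have [cp|ncp] := pselect (cdom c p).
  exists (cdom c); split=> //; first exact: cdom_open.
  apply: smooth_in_ext (smooth_in_chart Mc sG); first exact: cdom_open.
  by move=> q cq; rewrite patchE mem_set.
(* Hausdorff separation makes this compact set closed in [M]. Its complement is then an open
   neighbourhood of [p] on which the extension vanishes. *)
have clK : closed (cinv c @` K).
  apply: compact_closed; first exact: points_hausdorff.
  apply: continuous_compact => //; apply: continuous_in_subspaceT => x /set_mem Kx.
  exact: cinv_cont (KU _ Kx).
have oK := closed_openC clK.
exists (~` (cinv c @` K)); split=> //.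
  by move=> [x /KU[q cq <-]]; rewrite cmapK// => qp; apply: ncp; rewrite -qp.
apply: (@smooth_in_ext _ (cst 0)) => // [q nKq|]; last exact/smooth_inW/smooth_cst.
rewrite patchE; case: ifPn => // /set_mem cq; rewrite /= G0// => Kq.
by apply: nKq; exists (cmap c q) => //; rewrite cmapK.
Qed.

End ManifoldSmooth.

(** * Local frames *)

Section TangentAlgebra.
Variables (R : realType) (n : nat) (M : manifold R n).
Implicit Types (p q : M) (f g : smoothfun M) (X Y Z : vector_field M) (b : one_form M).

Lemma smoothfun0E p : (0 : smoothfun M) p = 0.
Proof. by have /(congr1 (@^~ p)) := raddf0 (val : smoothfun M -> _). Qed.

Lemma smoothfun1E p : (1 : smoothfun M) p = 1.
Proof. by have /(congr1 (@^~ p)) := rmorph1 (val : smoothfun M -> _). Qed.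

Lemma smoothfunNE f p : (- f) p = - f p.
Proof. by have /(congr1 (@^~ p)) := raddfN (val : smoothfun M -> _) f. Qed.

Lemma smoothfunZE (a : R) f p : (a *: f) p = a * f p.
Proof. by rewrite -[a *: f]addr0 smoothfunPE smoothfun0E addr0. Qed.

Lemma smoothfun_sumE (I : Type) (r : seq I) (P : pred I) (F : I -> smoothfun M) p :
  (\sum_(i <- r | P i) F i) p = \sum_(i <- r | P i) F i p.
Proof.
by apply: (big_morph (fun f : smoothfun M => f p)) => [f g|];
  [exact: smoothfunDE|exact: smoothfun0E].
Qed.

Section Tangent.
Variable p : M.
Implicit Types (u v w : tangent p).

Lemma tangentD u f g : u (f + g) = u f + u g.
Proof. by have [l _] := tangentP u; rewrite -[f]scale1r l mul1r scale1r. Qed.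

Lemma tangent0 u : u 0 = 0.
Proof. by apply: (addrI (u 0)); rewrite -tangentD !addr0. Qed.

Lemma tangentZ u (a : R) f : u (a *: f) = a * u f.
Proof. by have [l _] := tangentP u; rewrite -[a *: f]addr0 l tangent0 addr0. Qed.

Lemma tangentN u f : u (- f) = - u f.
Proof. by rewrite -scaleN1r tangentZ mulN1r. Qed.

Lemma tangentM u f g : u (f * g) = f p * u g + g p * u f.
Proof. by have [_] := tangentP u; exact. Qed.

Lemma tangent1 u : u 1 = 0.
Proof.
apply: (addrI (u 1)); rewrite addr0 -[in RHS](mulr1 1) tangentM smoothfun1E.
by rewrite !mul1r.
Qed.

Lemma tangent_sum u (I : Type) (r : seq I) (P : pred I) (F : I -> smoothfun M) :
  u (\sum_(i <- r | P i) F i) = \sum_(i <- r | P i) u (F i).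
Proof. exact: (big_morph u (tangentD u) (tangent0 u)). Qed.

Lemma tangent_eq u v : (forall f, u f = v f) -> u = v.
Proof. by move=> uv; apply: val_inj; apply/funext. Qed.

(** Derivations kill constants, so [f] may be replaced by [f - f p]. *)
Lemma tangent_eq0 u v : (forall f, f p = 0 -> u f = v f) -> u = v.
Proof.
move=> uv; apply: tangent_eq => f.
have := uv (f - f p *: (1 : smoothfun M)); rewrite !tangentD !tangentN !tangentZ !tangent1.
rewrite mulr0 oppr0 !addr0; apply.
by rewrite smoothfunDE smoothfunNE smoothfunZE smoothfun1E mulr1 subrr.
Qed.

Lemma tangentDE u v f : (u + v) f = u f + v f.
Proof. by rewrite -[u]scale1r tangentPE mul1r scale1r. Qed.

Lemma tangentZE (a : R) u f : (a *: u) f = a * u f.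
Proof. by rewrite -[a *: u]addr0 tangentPE tangent0E addr0. Qed.

Lemma tangentNE u f : (- u) f = - u f.
Proof. by rewrite -scaleN1r tangentZE mulN1r. Qed.

Lemma tangent_sumE (I : Type) (r : seq I) (P : pred I) (F : I -> tangent p) f :
  (\sum_(i <- r | P i) F i) f = \sum_(i <- r | P i) F i f.
Proof.
by apply: (big_morph (fun u : tangent p => u f)) => [u v|];
  [exact: tangentDE|exact: tangent0E].
Qed.

End Tangent.

Section Dual.
Variable W : lmodType R.
Implicit Types (l m : dual W) (u v : W).

Lemma dualDE l m u : (l + m) u = l u + m u.
Proof. by rewrite -[l]scale1r dualPE mul1r scale1r. Qed.

Lemma dualZE (a : R) l u : (a *: l) u = a * l u.
Proof. by rewrite -[a *: l]addr0 dualPE dual0E addr0. Qed.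

Lemma dualNE l u : (- l) u = - l u.
Proof. by rewrite -scaleN1r dualZE mulN1r. Qed.

Lemma dual_linear l (a : R) u v : l (a *: u + v) = a * l u + l v.
Proof. by case: l => l /= /asboolP. Qed.

Lemma dualD l u v : l (u + v) = l u + l v.
Proof. by rewrite -[u]scale1r dual_linear mul1r scale1r. Qed.

Lemma dual0 l : l 0 = 0.
Proof. by apply: (addrI (l 0)); rewrite -dualD !addr0. Qed.

Lemma dualZ l (a : R) u : l (a *: u) = a * l u.
Proof. by rewrite -[a *: u]addr0 dual_linear dual0 addr0. Qed.

Lemma dualN l u : l (- u) = - l u.
Proof. by rewrite -scaleN1r dualZ mulN1r. Qed.

Lemma dual_sum l (I : Type) (r : seq I) (P : pred I) (F : I -> W) :
  l (\sum_(i <- r | P i) F i) = \sum_(i <- r | P i) l (F i).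
Proof. exact: (big_morph l (dualD l) (dual0 l)). Qed.

Lemma dual_eq l m : (forall u, l u = m u) -> l = m.
Proof. by move=> lm; apply: val_inj; apply/funext. Qed.

End Dual.

Lemma vf_atP (a : R) X Y p : (a *: X + Y) p = a *: X p + Y p.
Proof. by have /(congr1 (@^~ p)) := linearP (val : vector_field M -> _) a X Y. Qed.

Lemma vf_at0 p : (0 : vector_field M) p = 0.
Proof. by have /(congr1 (@^~ p)) := raddf0 (val : vector_field M -> _). Qed.

Lemma vf_atD X Y p : (X + Y) p = X p + Y p.
Proof. by rewrite -[X]scale1r vf_atP !scale1r. Qed.

Lemma vf_atZ (a : R) X p : (a *: X) p = a *: X p.
Proof. by rewrite -[a *: X]addr0 vf_atP vf_at0 addr0. Qed.

Lemma vf_atN X p : (- X) p = - X p.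
Proof. by rewrite -scaleN1r vf_atZ scaleN1r. Qed.

Lemma vf_at_sum (I : Type) (r : seq I) (P : pred I) (F : I -> vector_field M) p :
  (\sum_(i <- r | P i) F i) p = \sum_(i <- r | P i) F i p.
Proof.
by apply: (big_morph (fun X : vector_field M => X p)) => [X Y|];
  [exact: vf_atD|exact: vf_at0].
Qed.

Lemma vf_eq X Y : (forall p, X p = Y p) -> X = Y.
Proof. by move=> XY; apply: val_inj; apply: functional_extensionality_dep. Qed.

Lemma form_atP (a : R) b c p : (a *: b + c : one_form M) p = a *: b p + c p.
Proof. by have /(congr1 (@^~ p)) := linearP (val : one_form M -> _) a b c. Qed.

Lemma form_at0 p : (0 : one_form M) p = 0.
Proof. by have /(congr1 (@^~ p)) := raddf0 (val : one_form M -> _). Qed.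

Lemma form_atD b c p : (b + c : one_form M) p = b p + c p.
Proof. by rewrite -[b]scale1r form_atP !scale1r. Qed.

Lemma form_atZ (a : R) b p : (a *: b : one_form M) p = a *: b p.
Proof. by rewrite -[a *: b]addr0 form_atP form_at0 addr0. Qed.

Lemma form_atN b p : (- b) p = - b p.
Proof. by rewrite -scaleN1r form_atZ scaleN1r. Qed.

Fact vf_mul_smooth f X :
  ((fun p => f p *: X p) : depfun (fun p : M => tangent p : lmodType R)) \in @vf_pred R n M.
Proof.
apply/asboolP => g; rewrite (_ : (fun p => _) = f * vf_app X g :> (M -> R)).
  exact: smoothM (smoothfunP f) (vfP X g).
by apply/funext => p; rewrite tangentZE.
Qed.

Definition vf_mul f X : vector_field M := VectorField (vf_mul_smooth f X).

Fact form_mul_smooth f b :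
  ((fun p => f p *: b p) : depfun (fun p : M => cotangent p : lmodType R)) \in @form_pred R n M.
Proof.
apply/asboolP => X; rewrite (_ : (fun p => _) = f * form_app b X :> (M -> R)).
  exact: smoothM (smoothfunP f) (formP b X).
by apply/funext => p; rewrite dualZE.
Qed.

Definition form_mul f b : one_form M := OneForm (form_mul_smooth f b).

End TangentAlgebra.

(** * The cut off coordinate frame of one chart *)

Section LocalFrame.
Variables (R : realType) (n : nat) (M : manifold R n).
Variables (c : chart R n M) (Mc : atlas c) (a : 'rV[R]_n) (r : R) (r0 : 0 < r).
Hypothesis ball_chart : [set y | `|y - a| <= r] `<=` cmap c @` cdom c.

Let U := cmap c @` cdom c.
Let oU : open U := @cimg_open _ _ _ c.

Lemma smooth_bumpM (G : 'rV[R]_n -> R) : smooth_on U G -> smooth_on U (bump a r * G).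
Proof. by move=> sG k; exact: CkM oU (Ck_sub (subsetT U) (smoothE_bump a r k)) (sG k). Qed.

Lemma bumpM_support (G : 'rV[R]_n -> R) x : ~ `|x - a| <= r -> (bump a r * G) x = 0.
Proof.
move=> nxr; rewrite mulrfctE; have [->|/bump_support] := eqVneq (bump a r x) 0.
  by rewrite mul0r.
by move=> /(_ r0).
Qed.

Lemma smooth_cut (G : 'rV[R]_n -> R) : smooth_on U G ->
  smooth (((bump a r * G) \o cmap c) \_ (cdom c)).
Proof.
move=> sG; apply: (@smooth_patch _ _ _ c _ (bump a r * G) Mc (@compact_norm_ball _ _ a r) ball_chart).
  exact: smooth_bumpM.
by move=> x _; exact: bumpM_support.
Qed.

Definition cutoff G (sG : smooth_on U G) : smoothfun M := SmoothFunOf (smooth_cut sG).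

Lemma cutoff_in G (sG : smooth_on U G) q : cdom c q ->
  cutoff sG q = bump a r (cmap c q) * G (cmap c q).
Proof. by move=> cq; rewrite /= patchE mem_set. Qed.

Lemma cutoff_out G (sG : smooth_on U G) q : ~ cdom c q -> cutoff sG q = 0.
Proof. by move=> ncq; rewrite /= patchE memNset. Qed.

Lemma smooth_on_cst1 : smooth_on U (cst 1). Proof. by move=> k; exact: Ck_cst oU. Qed.

Lemma smooth_on_coord i : smooth_on U (fun x => x 0 i).
Proof. by move=> k; exact: Ck_coord oU. Qed.

Lemma smooth_on_partial (f : smoothfun M) i :
  smooth_on U ('D_(delta_mx 0 i) (f \o cinv c)).
Proof. by move=> k; exact: ((smoothfunP f Mc k.+1).2 i).2. Qed.

Lemma chart_derivable (f : smoothfun M) q i : cdom c q ->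
  derivable (f \o cinv c) (cmap c q) (delta_mx 0 i).
Proof. by move=> cq; apply: (Ck_derivable (smoothfunP f Mc 1%N)); exists q. Qed.

Lemma partial_derivation i (q : M) :
  is_derivation q (fun f => cutoff (smooth_on_partial f i) q).
Proof.
have [cq|ncq] := pselect (cdom c q); last first.
  by split=> [b f g|f g]; rewrite !cutoff_out// !mulr0 addr0.
have d f := @chart_derivable f q i cq.
split=> [b f g|f g]; rewrite !cutoff_in//.
  rewrite (_ : (b *: f + g : smoothfun M) \o cinv c = b *: (f \o cinv c) + (g \o cinv c)).
    by rewrite deriveD ?deriveZ//; [rewrite -[_ *: _]/(_ * _); ring|exact: derivableZ].
  by apply/funext => x; exact: smoothfunPE.
rewrite (_ : (f * g : smoothfun M) \o cinv c = (f \o cinv c) * (g \o cinv c)).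
  by rewrite deriveM// /= cmapK// -![_ *: _]/(_ * _); ring.
by apply/funext => x; exact: smoothfunME.
Qed.

Fact partial_smooth i : ((fun q => TangentOf (partial_derivation i q))
  : depfun (fun q : M => tangent q : lmodType R)) \in @vf_pred R n M.
Proof. by apply/asboolP => f; exact: smoothfunP. Qed.

Definition chart_field i : vector_field M := VectorField (partial_smooth i).

Let chi := cutoff smooth_on_cst1.
Let y i := cutoff (smooth_on_coord i).

(** With [y_i = chi x_i] this is [chi ^ 2 dx_i], written through differentials of global functions.
    Against the fields [chart_field i], which are [chi] times the coordinate fields, it produces the
    factor [chi ^ 3] below. *)
Definition chart_coform i : one_form M :=
  form_mul chi (differential (y i)) - form_mul (y i) (differential chi).

Lemma chart_coformE i q (D : tangent q) :
  chart_coform i q D = chi q * D (y i) - y i q * D chi.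
Proof. by rewrite form_atD form_atN dualDE dualNE !dualZE. Qed.

(* [f] vanishing at [q], Hadamard's lemma at [cmap c q] applied to the cut off
   [chi * f] gives [chi ^ 3 * f = \sum_i (y_i - x_i(q) chi) * g_i]. *)
Lemma chart_expansion q (D : tangent q) :
  (chi * chi * chi) q *: D = \sum_i chart_coform i q D *: chart_field i q.
Proof.
have [cq|ncq] := pselect (cdom c q); last first.
  rewrite smoothfunME [chi q]cutoff_out// mulr0 scale0r big1// => i _.
  by rewrite chart_coformE [y i q]cutoff_out// [chi q]cutoff_out// !mul0r subrr scale0r.
apply: tangent_eq0 => f fq0; rewrite tangentZE tangent_sumE.
pose x0 := cmap c q; pose h := f \o cinv c.
have Ux0 : U x0 by exists q.
(* Extended by zero, [F] is smooth on the whole space, so the segments of Hadamard's lemma may leave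
   the chart image. *)
pose F := (bump a r * h) \_ U.
have sh : smooth_on U h by exact: smoothfunP.
have sF : smoothE F.
  apply: (@smoothE_patch _ _ U [set y | `|y - a| <= r]) => //.
  - exact: compact_closed (@norm_hausdorff _ _) (@compact_norm_ball _ _ a r).
  - exact: smooth_bumpM.
  - by move=> x _; exact: bumpM_support.
pose g i := segint x0 0 ('D_(delta_mx 0 i) F).
have sg i : smooth_on U (g i).
  by move=> k; apply: Ck_sub (smoothE_segint _ _ (smoothE_partial i sF) k).
have F0 : F x0 = 0.
  by rewrite /F patchE mem_set// mulrfctE /h /= cmapK// fq0 mulr0.
have gx0 i : g i x0 = bump a r x0 * 'D_(delta_mx 0 i) h x0.
  rewrite /g segint_center.
  have -> : 'D_(delta_mx 0 i) F x0 = 'D_(delta_mx 0 i) (bump a r * h) x0.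
    apply: near_eq_derive.
    apply: filterS (open_nbhs_nbhs (conj oU Ux0)) => x Ux.
    by rewrite /F patchE mem_set.
  rewrite deriveM; [|exact: Ck_derivable (smoothE_bump a r 1%N) _|exact: chart_derivable].
  by rewrite /h /= cmapK// fq0 scale0r addr0.
(* One factor [chi] turns [f] into [F], one turns [x_i - x_i(q)] into [y_i - x_i(q) chi], and one
   cuts off [g_i]. *)
have E : chi * chi * chi * f = \sum_i (y i - x0 0 i *: chi) * cutoff (sg i).
  apply: smoothfun_eq => p; rewrite !smoothfunME smoothfun_sumE.
  have [cp|ncp] := pselect (cdom c p); last first.
    rewrite [chi p]cutoff_out// !mul0r big1// => i _.
    by rewrite smoothfunME [cutoff (sg i) p]cutoff_out// mulr0.
  have Fp : F (cmap c p) = bump a r (cmap c p) * f p.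
    by rewrite /F patchE mem_set ?mulrfctE /h /= ?cmapK//; exists p.
  rewrite [chi p]cutoff_in// mulr1 -mulrA -Fp (hadamard x0 _ sF) F0 add0r mulr_sumr.
  apply: eq_bigr => i _; rewrite smoothfunME smoothfunDE smoothfunNE smoothfunZE.
  by rewrite [y i p]cutoff_in// [chi p]cutoff_in// [cutoff _ p]cutoff_in// /g /=; ring.
(* Both [f] and the factors [y_i - x_i(q) chi] vanish at [q], so the Leibniz rule leaves a single
   term on the left and one in each summand on the right. *)
have := congr1 D E; rewrite tangentM fq0 mul0r addr0 tangent_sum => ->.
apply: eq_bigr => i _; rewrite tangentM tangentZE chart_coformE.
rewrite smoothfunDE smoothfunNE smoothfunZE [y i q]cutoff_in// [chi q]cutoff_in//.
rewrite [chart_field i q f]cutoff_in// [cutoff _ q]cutoff_in// gx0.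
rewrite tangentD tangentN tangentZ /x0 /h -![cst 1 _]/(1 : R); ring.
Qed.

End LocalFrame.

Lemma local_frame (R : realType) (n : nat) (M : manifold R n) (p : M) :
  exists (chi : smoothfun M) (E : 'I_n -> vector_field M) (theta : 'I_n -> one_form M),
    chi p != 0 /\
    forall q (D : tangent q), chi q *: D = \sum_i theta i q D *: E i q.
Proof.
have [c Mc cp] := atlas_cover p.
have [r r0 rU] : exists2 r : R, 0 < r &
    [set y | `|y - cmap c p| <= r] `<=` cmap c @` cdom c.
  have Up : (cmap c @` cdom c) (cmap c p) by exists p.
  have /nbhs_ballP[r /= r0 rU] := open_nbhs_nbhs (conj (@cimg_open _ _ _ c) Up).
  exists (r / 2); first by rewrite divr_gt0.
  move=> y /= yr; apply: rU; rewrite -ball_normE/= distrC (le_lt_trans yr)//.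
  by rewrite ltr_pdivrMr// ltr_pMr// ltr1n.
pose chi := cutoff Mc r0 rU (@smooth_on_cst1 R n M c).
exists (chi * chi * chi), (chart_field Mc r0 rU), (chart_coform Mc r0 rU); split.
  rewrite !smoothfunME !cutoff_in// mulr1.
  by rewrite !mulf_neq0// bump_center.
by move=> q D; exact: chart_expansion.
Qed.

(** * Tensoriality and the Lie derivative *)

Section Tensoriality.
Variables (R : realType) (n : nat) (M : manifold R n).
Implicit Types (p q : M) (f g : smoothfun M) (X Y Z : vector_field M) (b : one_form M).

Lemma vf_mulE f X p : vf_mul f X p = f p *: X p. Proof. by []. Qed.

Lemma vf_appE X f p : vf_app X f p = X p f. Proof. by []. Qed.

Lemma form_appE b X p : form_app b X p = b p (X p). Proof. by []. Qed.

Lemma vf_mul_cst (a : R) X : vf_mul (a *: (1 : smoothfun M)) X = a *: X.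
Proof. by apply: vf_eq => p; rewrite vf_mulE vf_atZ smoothfunZE smoothfun1E mulr1. Qed.

Definition tensorial (T : vector_field M -> smoothfun M) : Prop :=
  (forall X Y, T (X + Y) = T X + T Y) /\ (forall f X, T (vf_mul f X) = f * T X).

Lemma tensorial_pointwise T X Y p : tensorial T -> X p = Y p -> T X p = T Y p.
Proof.
move=> [TD TM] XYp; have [chi [E [theta [chip frame]]]] := local_frame p.
have T0 : T 0 = 0 by apply: (addrI (T 0)); rewrite -TD !addr0.
(* [T] is applied to the identity [chi Z = \sum_i theta_i(Z) E_i] between global fields; at [p] the
   coefficients see only [Z p]. *)
have TE Z : chi p * T Z p = \sum_i theta i p (Z p) * T (E i) p.
  rewrite -smoothfunME -TM.
  have -> : vf_mul chi Z = \sum_i vf_mul (form_app (theta i) Z) (E i).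
    by apply: vf_eq => q; rewrite vf_mulE frame vf_at_sum.
  rewrite (big_morph T TD T0) smoothfun_sumE.
  by apply: eq_bigr => i _; rewrite TM smoothfunME.
by apply: (mulfI chip); rewrite !TE XYp.
Qed.

(** A combination of the frame fields with constant coefficients, the components of [w] divided by
    [chi p]. *)
Lemma tangent_extension p (w : tangent p) : exists Z, Z p = w.
Proof.
have [chi [E [theta [chip frame]]]] := local_frame p.
exists ((chi p)^-1 *: \sum_i theta i p w *: E i); rewrite vf_atZ vf_at_sum.
under eq_bigr do rewrite vf_atZ.
by rewrite -frame scalerA mulVf// scale1r.
Qed.

(** Each tangent vector is extended by choice, with no regularity in [p]. Pointwise dependence makes
    the choice irrelevant, and smoothness follows because the form takes the value [T Z] on a field
    [Z]. *)
Lemma tensorial_form T : tensorial T -> exists b, forall Z, form_app b Z = T Z.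
Proof.
move=> tT; have [TD TM] := tT.
pose ext p (w : tangent p) := sval (cid (tangent_extension w)).
have extE p (w : tangent p) : ext p w p = w by rewrite /ext; case: cid.
have TZ (a : R) X : T (a *: X) = a *: T X.
  by rewrite -vf_mul_cst TM; apply: smoothfun_eq => p;
     rewrite smoothfunME !smoothfunZE smoothfun1E mulr1.
have lin p (a : R) (u v : tangent p) :
    T (ext p (a *: u + v)) p = a * T (ext p u) p + T (ext p v) p.
  rewrite -smoothfunPE -TZ -TD; apply: tensorial_pointwise => //.
  by rewrite extE vf_atP !extE.
have TE Z p : T (ext p (Z p)) p = T Z p.
  by apply: tensorial_pointwise; rewrite ?extE.
have sm : ((fun p => DualOf (lin p))
    : depfun (fun p : M => cotangent p : lmodType R)) \in @form_pred R n M.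
  apply/asboolP => Z; rewrite (_ : (fun p => _) = T Z); first exact: smoothfunP.
  by apply/funext => p; exact: TE.
by exists (OneForm sm) => Z; apply: smoothfun_eq => p; exact: TE.
Qed.

Lemma form_eq b b' : (forall Z p, b p (Z p) = b' p (Z p)) -> b = b'.
Proof.
move=> bc; apply: val_inj; apply: functional_extensionality_dep => p.
by apply: dual_eq => w; have [Z <-] := tangent_extension w; exact: bc.
Qed.

Lemma lie_bracketE X Y p f : lie_bracket X Y p f = X p (vf_app Y f) - Y p (vf_app X f).
Proof. by []. Qed.

Lemma lie_bracketC X Y : lie_bracket Y X = - lie_bracket X Y.
Proof.
apply: vf_eq => p; apply: tangent_eq => f.
by rewrite vf_atN tangentNE !lie_bracketE opprB.
Qed.

Lemma vf_appDl X Y f : vf_app (X + Y) f = vf_app X f + vf_app Y f.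
Proof. by apply: smoothfun_eq => p; rewrite smoothfunDE !vf_appE vf_atD tangentDE. Qed.

Lemma vf_app_mul f X g : vf_app (vf_mul f X) g = f * vf_app X g.
Proof. by apply: smoothfun_eq => p; rewrite smoothfunME !vf_appE tangentZE. Qed.

Lemma lie_bracketDr X Y Z : lie_bracket X (Y + Z) = lie_bracket X Y + lie_bracket X Z.
Proof.
apply: vf_eq => p; apply: tangent_eq => f; rewrite vf_atD tangentDE !lie_bracketE.
by rewrite vf_appDl tangentD vf_atD tangentDE; ring.
Qed.

Lemma lie_bracket_mulr X f Y p :
  lie_bracket X (vf_mul f Y) p = f p *: lie_bracket X Y p + X p f *: Y p.
Proof.
apply: tangent_eq => g; rewrite tangentDE !tangentZE !lie_bracketE.
by rewrite vf_app_mul tangentM vf_mulE tangentZE /=; ring.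
Qed.

Lemma lie_bracketDl X Y Z : lie_bracket (X + Y) Z = lie_bracket X Z + lie_bracket Y Z.
Proof. by rewrite lie_bracketC lie_bracketDr opprD -!lie_bracketC. Qed.

Lemma lie_bracket_mull f X Y p :
  lie_bracket (vf_mul f X) Y p = f p *: lie_bracket X Y p - Y p f *: X p.
Proof.
rewrite lie_bracketC vf_atN lie_bracket_mulr opprD -scalerN -vf_atN.
by rewrite -lie_bracketC.
Qed.

Lemma lie_bracket0l X : lie_bracket 0 X = 0.
Proof. by apply: (addrI (lie_bracket 0 X)); rewrite -lie_bracketDl !addr0. Qed.

Lemma form_appDr b X Y : form_app b (X + Y) = form_app b X + form_app b Y.
Proof. by apply: smoothfun_eq => p; rewrite smoothfunDE !form_appE vf_atD dualD. Qed.

Lemma form_app_mul b f X : form_app b (vf_mul f X) = f * form_app b X.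
Proof. by apply: smoothfun_eq => p; rewrite smoothfunME !form_appE dualZ. Qed.

(** The term [X f * b Z] from the Leibniz rule cancels the one from the bracket of [X] with
    [f Z]. *)
Lemma lie_derivative_tensorial X b :
  tensorial (fun Z => vf_app X (form_app b Z) - form_app b (lie_bracket X Z)).
Proof.
split=> [Y Z|f Z]; apply: smoothfun_eq => p.
  rewrite !(smoothfunDE, smoothfunNE) lie_bracketDr !form_appDr smoothfunDE.
  by rewrite !vf_appE tangentD !form_appE; ring.
rewrite smoothfunME !(smoothfunDE, smoothfunNE) form_app_mul.
rewrite !vf_appE tangentM !form_appE lie_bracket_mulr dualD !dualZ; ring.
Qed.

Lemma lie_derivativeE X b Z p :
  lie_derivative X b p (Z p) = X p (form_app b Z) - b p (lie_bracket X Z p).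
Proof.
(* Tensoriality supplies the form required by [xget], which therefore does not return its default
   value. *)
have := xgetPex 0 (tensorial_form (lie_derivative_tensorial X b)).
move=> /(_ Z)/(congr1 (fun f : smoothfun M => f p)).
by rewrite smoothfunDE smoothfunNE.
Qed.

(** * The musical map of a 2-form, its exterior derivative and Cartan's formula *)

Variable s : two_form M.

Section Pointwise.
Variable p : M.
Implicit Types (u v w : tangent p).

Lemma flatE u v : flat s u v = s p u v. Proof. by []. Qed.

Lemma flat_linearl (a : R) u v : flat s (a *: u + v) = a *: flat s u + flat s v.
Proof. by apply: dual_eq => w; rewrite dualPE !flatE tf_linear. Qed.

Lemma flatD u v : flat s (u + v) = flat s u + flat s v.
Proof. by rewrite -[u]scale1r flat_linearl !scale1r. Qed.

Lemma flat0 : flat s (0 : tangent p) = 0.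
Proof. by apply: (addrI (flat s 0)); rewrite -flatD !addr0. Qed.

Lemma flatZ (a : R) u : flat s (a *: u) = a *: flat s u.
Proof. by rewrite -[a *: u]addr0 flat_linearl flat0 addr0. Qed.

Lemma flatN u : flat s (- u) = - flat s u.
Proof. by rewrite -scaleN1r flatZ scaleN1r. Qed.

Lemma flat_sum (I : Type) (r : seq I) (P : pred I) (F : I -> tangent p) :
  flat s (\sum_(i <- r | P i) F i) = \sum_(i <- r | P i) flat s (F i).
Proof. exact: (big_morph (@flat _ _ _ s p) flatD flat0). Qed.

End Pointwise.

Fact flat_form_smooth X :
  ((fun p => flat s (X p)) : depfun (fun p : M => cotangent p : lmodType R))
    \in @form_pred R n M.
Proof. by apply/asboolP => Y; exact: tf_smooth. Qed.

Definition flat_form X : one_form M := OneForm (flat_form_smooth X).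

Lemma flat_formE X p : flat_form X p = flat s (X p). Proof. by []. Qed.

Lemma ext_derivE X Y Z p : ext_deriv s X Y Z p =
  X p (tf_app s Y Z) - Y p (tf_app s X Z) + Z p (tf_app s X Y)
  - flat s (lie_bracket X Y p) (Z p) + flat s (lie_bracket X Z p) (Y p)
  - flat s (lie_bracket Y Z p) (X p).
Proof. by rewrite !(smoothfunDE, smoothfunNE). Qed.

Lemma tf_appE X Y p : tf_app s X Y p = flat s (X p) (Y p). Proof. by []. Qed.

Lemma tf_appDl X Y Z : tf_app s (X + Y) Z = tf_app s X Z + tf_app s Y Z.
Proof.
apply: smoothfun_eq => p; rewrite smoothfunDE.
by rewrite -[LHS]/(flat s ((X + Y) p) (Z p)) vf_atD flatD dualDE.
Qed.

Lemma tf_app_mull f X Y : tf_app s (vf_mul f X) Y = f * tf_app s X Y.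
Proof.
apply: smoothfun_eq => p; rewrite smoothfunME.
by rewrite -[LHS]/(flat s (f p *: X p) (Y p)) flatZ dualZE.
Qed.

Lemma tf_appC X Y : tf_app s Y X = - tf_app s X Y.
Proof. by apply: smoothfun_eq => p; rewrite smoothfunNE; exact: tf_skew. Qed.

Lemma flatC p (u v : tangent p) : flat s u v = - flat s v u.
Proof. exact: tf_skew. Qed.

(** The derivatives of [f] along [Y] and [Z] cancel those contributed by the brackets of [f X] with
    [Y] and [Z]. *)
Lemma ext_deriv_tensorial Y Z : tensorial (fun X => ext_deriv s X Y Z).
Proof.
split=> [X X'|f X]; apply: smoothfun_eq => p.
  rewrite smoothfunDE !ext_derivE !tf_appDl !lie_bracketDl !vf_atD !tangentDE.
  by rewrite !tangentD !flatD !dualDE dualD; ring.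
rewrite smoothfunME !ext_derivE !tf_app_mull !lie_bracket_mull vf_mulE.
rewrite !tangentZE !tangentM !flatD !flatN !flatZ !dualDE !dualNE !dualZE dualZ.
by rewrite !tf_appE; ring.
Qed.

Lemma ext_derivC X Y Z p : ext_deriv s Y X Z p = - ext_deriv s X Y Z p.
Proof.
by rewrite !ext_derivE (lie_bracketC X Y) (tf_appC X Y) vf_atN flatN tangentN dualNE; ring.
Qed.

Lemma ext_deriv_pointwise X Y X' Y' Z p : X p = X' p -> Y p = Y' p ->
  ext_deriv s X Y Z p = ext_deriv s X' Y' Z p.
Proof.
move=> XX' YY'; rewrite (tensorial_pointwise (ext_deriv_tensorial Y Z) XX').
rewrite ext_derivC (tensorial_pointwise (ext_deriv_tensorial X' Z) YY').
by rewrite -ext_derivC.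
Qed.

Lemma ext_deriv0 X Z p : ext_deriv s 0 X Z p = 0.
Proof.
have [_ TM] := ext_deriv_tensorial X Z.
rewrite (_ : 0 = vf_mul 0 0) ?TM ?mul0r ?smoothfun0E//.
by apply: vf_eq => q; rewrite vf_mulE !vf_at0 scaler0.
Qed.

(* [i_Y i_X d sigma = L_X i_Y sigma - L_Y i_X sigma + d (sigma (X, Y)) - i_[X, Y] sigma] *)
Lemma cartan_identity X Y Z p :
  lie_derivative X (flat_form Y) p (Z p) - lie_derivative Y (flat_form X) p (Z p)
    + Z p (tf_app s X Y) =
  flat s (lie_bracket X Y p) (Z p) + ext_deriv s X Y Z p.
Proof.
rewrite !lie_derivativeE ext_derivE !flat_formE.
rewrite [flat s (Y p) _]flatC [flat s (X p) _]flatC.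
have E W W' : form_app (flat_form W) W' = tf_app s W W' by exact: smoothfun_eq.
by rewrite !E; ring.
Qed.

End Tensoriality.

(** * The skew classical structure *)

Section SkewClassical.
Variables (R : realType) (n : nat) (M : manifold R n).
Unset Implicit Arguments.
Variables (V : forall p : M, set (tangent p)) (s : two_form M).
Set Implicit Arguments.
Hypothesis V_subbundle : is_subbundle V.
Hypothesis s_nondegenerate : nondegenerate_on s V.
Hypothesis TM_sum : forall p : M, direct_sum (V p) (ker_flat s p).

Local Notation sharp := (sharp V s).

Lemma subbundle_linear p (a : R) (u v : tangent p) : V p u -> V p v -> V p (a *: u + v).
Proof.
have [U [r [X [_ Up frame]]]] := V_subbundle p.
have [-> _] := frame p Up => -[c _ <-] [d _ <-]; exists (a *: c + d) => //.
rewrite scaler_sumr -big_split/=; apply: eq_bigr => i _.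
by rewrite !mxE scalerDl scalerA.
Qed.

Lemma subbundle0 p : V p 0.
Proof.
have [U [r [X [_ Up frame]]]] := V_subbundle p.
have [-> _] := frame p Up; exists 0 => //.
by rewrite big1// => i _; rewrite mxE scale0r.
Qed.

Lemma subbundleD p (u v : tangent p) : V p u -> V p v -> V p (u + v).
Proof. by move=> Vu Vv; rewrite -[u]scale1r; exact: subbundle_linear. Qed.

Lemma subbundleN p (u : tangent p) : V p u -> V p (- u).
Proof.
move=> Vu; rewrite -scaleN1r -[_ *: _]addr0.
by apply: subbundle_linear => //; exact: subbundle0.
Qed.

(** Two candidates differ by a vector of [V] that is sigma-orthogonal to [V], hence zero by
    nondegeneracy; so [xget] can only return [- v]. *)
Lemma sharp_unique p (v : tangent p) (a b : cotangent p) :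
  V p v -> ann V b -> a = flat s v + b -> sharp a = - v.
Proof.
move=> Vv annb ab; apply: xget_unique; first by exists v, b.
move=> _ [w [b' [Vw annb' ab' ->]]]; congr (- _); apply/eqP; rewrite -subr_eq0.
apply/eqP/s_nondegenerate; first by apply: subbundleD => //; exact: subbundleN.
move=> x Vx; rewrite -flatE flatD flatN dualDE dualNE; apply/eqP; rewrite subr_eq0.
have := congr1 (fun l : cotangent p => l x) ab'.
by rewrite ab !dualDE (annb _ Vx) (annb' _ Vx) !addr0 => ->.
Qed.

(** * The Gram matrix of [s] in a local frame of [V] *)

Section Frame.
Variables (U : set M) (r : nat) (X : 'I_r -> vector_field M).
Hypothesis X_frame : forall q, U q ->
  V q = [set \sum_i c 0 i *: X i q | c in [set: 'rV[R]_r]] /\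
  forall c : 'rV[R]_r, \sum_i c 0 i *: X i q = 0 -> c = 0.

Definition gram q : 'M[R]_r := \matrix_(i, j) flat s (X i q) (X j q).

Lemma frame_in q (c : 'rV[R]_r) : U q -> V q (\sum_i c 0 i *: X i q).
Proof. by move=> Uq; have [-> _] := X_frame Uq; exists c. Qed.

Lemma gramE q (c : 'rV[R]_r) j :
  (c *m gram q) 0 j = flat s (\sum_i c 0 i *: X i q) (X j q).
Proof.
rewrite mxE flat_sum (big_morph (fun l : cotangent q => l (X j q)) (id1 := 0) (op1 := +%R));
  [|by move=> l m; rewrite dualDE|exact: dual0E].
by apply: eq_bigr => i _; rewrite mxE flatZ dualZE.
Qed.

Lemma frame_ext q (a b : cotangent q) : U q ->
  (forall j, a (X j q) = b (X j q)) -> forall v, V q v -> a v = b v.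
Proof.
move=> Uq ab v; have [-> _] := X_frame Uq => -[c _ <-].
by rewrite !dual_sum; apply: eq_bigr => i _; rewrite !dualZ ab.
Qed.

Lemma gram_unit q : U q -> gram q \in unitmx.
Proof.
move=> Uq; rewrite -row_free_unit; apply: inj_row_free => c cG.
apply: (X_frame Uq).2; apply: s_nondegenerate; first exact: frame_in.
move=> v Vv; rewrite -flatE -(dual0E v); apply: (frame_ext Uq) => // j.
by rewrite -gramE cG mxE dual0E.
Qed.

Definition frame_row q (a : cotangent q) : 'rV[R]_r := \row_j a (X j q).

(** The coefficients solve the linear system saying that [flat s v] and [a] agree on the frame; the
    remainder then annihilates [V]. *)
Lemma sharp_frame q (a : cotangent q) : U q ->
  exists2 b : cotangent q, ann V b &
    a = flat s (\sum_i (frame_row a *m invmx (gram q)) 0 i *: X i q) + b.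
Proof.
move=> Uq; set v := \sum_i _; exists (a - flat s v); last by rewrite addrC subrK.
move=> w Vw; rewrite dualDE dualNE; apply/eqP; rewrite subr_eq0; apply/eqP.
apply: (frame_ext Uq) Vw => j.
by rewrite -gramE mulmxKV ?gram_unit// mxE.
Qed.

Lemma sharp_frameE q (a : cotangent q) : U q ->
  sharp a = - \sum_i (frame_row a *m invmx (gram q)) 0 i *: X i q.
Proof.
move=> Uq; have [b annb ab] := sharp_frame a Uq.
exact: sharp_unique (frame_in _ Uq) annb ab.
Qed.

End Frame.

Lemma sharp_spec p (a : cotangent p) : exists v b,
  [/\ V p v, ann V b, a = flat s v + b & sharp a = - v].
Proof.
have [U [r [X [_ Up frame]]]] := V_subbundle p.
have [b annb ab] := sharp_frame frame a Up.
have Vv := frame_in frame (frame_row X a *m invmx (gram X p)) Up.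
by eexists _, b; split; [exact: Vv|exact: annb|exact: ab|exact: sharp_unique Vv annb ab].
Qed.

Lemma V_sharp p (a : cotangent p) : V p (sharp a).
Proof. by have [v [b [Vv _ _ ->]]] := sharp_spec a; exact: subbundleN. Qed.

Lemma ann_linear p (a b : cotangent p) (c : R) : ann V a -> ann V b -> ann V (c *: a + b).
Proof. by move=> Va Vb v Vv; rewrite dualPE Va// Vb// mulr0 addr0. Qed.

Lemma ann0 p : ann V (0 : cotangent p).
Proof. by move=> v _; rewrite dual0E. Qed.

Lemma sharp_linear p (c : R) (a b : cotangent p) :
  sharp (c *: a + b) = c *: sharp a + sharp b.
Proof.
have [v [a' [Vv anna aE ->]]] := sharp_spec a.
have [w [b' [Vw annb bE ->]]] := sharp_spec b.
rewrite (@sharp_unique _ (c *: v + w) _ (c *: a' + b')).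
- by rewrite scalerN opprD.
- exact: subbundle_linear.
- exact: ann_linear.
- by rewrite aE bE flat_linearl scalerDr addrACA.
Qed.

Lemma sharpN p (a : cotangent p) : sharp (- a) = - sharp a.
Proof.
have [v [b [Vv annb aE ->]]] := sharp_spec a.
rewrite (@sharp_unique _ (- v) _ (- b)) //; first exact: subbundleN.
  by move=> w Vw; rewrite dualNE annb// oppr0.
by rewrite aE opprD flatN.
Qed.

Lemma sharp_flat p (v : tangent p) : V p v -> sharp (flat s v) = - v.
Proof. by move=> Vv; exact: sharp_unique Vv (@ann0 p) (esym (addr0 _)). Qed.

(** Here the complement [ker_flat s] of [V] enters: [flat s u] depends only on the component of [u]
    in [V], where [sharp] inverts [flat s] up to sign. *)
Lemma flat_sharp_flat p (u : tangent p) : flat s (sharp (flat s u)) = - flat s u.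
Proof.
have [[v k] [[/= Vv kerk ->] _]] := TM_sum u.
by rewrite flatD kerk addr0 sharp_flat// flatN.
Qed.

(** Evaluation is made a ring morphism so that it commutes with determinants and adjugates of
    matrices of smooth functions. *)
Definition smoothfun_eval p (f : smoothfun M) : R := f p.
Fact smoothfun_eval_is_zmod_morphism p : zmod_morphism (smoothfun_eval p).
Proof. by move=> f g; rewrite /smoothfun_eval smoothfunDE smoothfunNE. Qed.
Fact smoothfun_eval_is_monoid_morphism p : monoid_morphism (smoothfun_eval p).
Proof. by split=> [|f g]; rewrite /smoothfun_eval ?smoothfun1E ?smoothfunME. Qed.
HB.instance Definition _ p :=
  GRing.isZmodMorphism.Build _ _ (smoothfun_eval p) (smoothfun_eval_is_zmod_morphism p).
HB.instance Definition _ p :=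
  GRing.isMonoidMorphism.Build _ _ (smoothfun_eval p) (smoothfun_eval_is_monoid_morphism p).

(* Cramer's rule exhibits [sharp] locally as a quotient of global smooth functions. *)
Lemma sharp_smooth (b : one_form M) :
  ((fun p => sharp (b p)) : depfun (fun p : M => tangent p : lmodType R)) \in @vf_pred R n M.
Proof.
apply/asboolP => f; apply: smooth_local => p.
have [U [r [X [oU Up frame]]]] := V_subbundle p; exists U; split=> //.
pose G : 'M[smoothfun M]_r := \matrix_(i, j) tf_app s (X i) (X j).
pose B : 'rV[smoothfun M]_r := \row_j form_app b (X j).
(* The adjugate has entries in the ring of smooth functions, unlike the inverse; on [U], [N] is
   [\det G] times the function whose smoothness is sought. *)
pose N := - \sum_i (B *m \adj G) 0 i * vf_app (X i) f.
have GE q : map_mx (smoothfun_eval q) G = gram X q by apply/matrixP => i j; rewrite !mxE.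
have BE q : map_mx (smoothfun_eval q) B = frame_row X (b q) by apply/rowP => j; rewrite !mxE.
have detE q : (\det G) q = \det (gram X q) by rewrite -GE det_map_mx.
apply: (@smooth_div _ _ _ _ N (\det G)) => //; try exact: smoothfunP.
  by move=> q Uq; rewrite detE; have := gram_unit frame Uq; rewrite unitmxE unitfE.
move=> q Uq; have uG := gram_unit frame Uq.
have dG : \det (gram X q) != 0 by move: uG; rewrite unitmxE unitfE.
rewrite detE (sharp_frameE frame _ Uq) tangentNE tangent_sumE mulrN mulr_sumr.
rewrite smoothfunNE smoothfun_sumE; congr (- _); apply: eq_bigr => i _.
rewrite smoothfunME tangentZE mulrA vf_appE; congr (_ * _).
have -> : (B *m \adj G) 0 i q = (map_mx (smoothfun_eval q) (B *m \adj G)) 0 i by rewrite [RHS]mxE.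
rewrite map_mxM map_mx_adj BE GE /invmx uG -scalemxAr [in LHS]mxE mulrA.
by rewrite divff ?mul1r.
Qed.

Definition sharp_field (b : one_form M) : vector_field M := VectorField (sharp_smooth b).

Lemma sharp_fieldE b p : sharp_field b p = sharp (b p). Proof. by []. Qed.

(* The projection of a vector field to [V] along [ker flat_sigma]. *)
Definition V_projection (X : vector_field M) : vector_field M :=
  - sharp_field (flat_form s X).

Lemma V_projection_in (X : vector_field M) p : V p (V_projection X p).
Proof. by rewrite vf_atN; apply: subbundleN; exact: V_sharp. Qed.

Lemma V_projection_id (X : vector_field M) p : V p (X p) -> V_projection X p = X p.
Proof. by move=> VX; rewrite vf_atN sharp_fieldE sharp_flat// opprK. Qed.

Local Notation Phi := (skew_classical_structure V s).

(** For skewness, writing both covectors as [flat s v] and [flat s w] plus annihilators of [V] turns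
    the [sharp] terms into values of sigma on [(v, w)] and [(w, v)], which cancel like the [flat]
    terms. The cubic identity says that each of [flat] and [sharp], composed with the other and then
    with itself, changes sign. *)
Lemma skew_classical_generalized_F : generalized_F Phi.
Proof.
split.
- split=> [p a u v|A].
    by rewrite /skew_classical_structure/= sharp_linear flat_linearl.
  by exists (sharp_field A.2, flat_form s A.1).
- move=> p [x a] [y b]; rewrite /metric/=.
  have [v [a' [Vv anna -> ->]]] := sharp_spec a.
  have [w [b' [Vw annb -> ->]]] := sharp_spec b.
  rewrite !dualN !dualDE (anna _ Vw) (annb _ Vv) ?flatE (tf_skew s w v) (tf_skew s y x).
  ring.
- move=> p [x a]; rewrite /skew_classical_structure/=.
  congr pair => /=; last by rewrite flat_sharp_flat addNr.
  by rewrite sharp_flat ?addNr//; exact: V_sharp.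
Qed.

(** These are the real and imaginary parts of [alpha = - i flat X]. The eigenvalue equation also
    exhibits both parts of [X], up to sign, as values of [sharp], whence they lie in [V]. *)
Lemma i_eigenbundleP p (z : cplx (big_tangent p)) : i_eigenbundle Phi z <->
  [/\ V p z.1.1, V p z.2.1, z.1.2 = flat s z.2.1 & z.2.2 = - flat s z.1.1].
Proof.
case: z => -[x1 a1] [x2 a2]; split=> /=.
  move=> E.
  have e1 : sharp a1 = - x2 by have := congr1 (fun z : cplx (big_tangent p) => z.1.1) E.
  have e2 : flat s x1 = - a2 by have := congr1 (fun z : cplx (big_tangent p) => z.1.2) E.
  have e3 : sharp a2 = x1 by have := congr1 (fun z : cplx (big_tangent p) => z.2.1) E.
  have e4 : flat s x2 = a1 by have := congr1 (fun z : cplx (big_tangent p) => z.2.2) E.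
  split=> //.
  - by rewrite -e3; exact: V_sharp.
  - by rewrite -[x2]opprK -e1; apply: subbundleN; exact: V_sharp.
  - by rewrite e2 opprK.
move=> [V1 V2 -> ->]; rewrite /i_eigenbundle /cplx_map /cplx_muli /skew_classical_structure/=.
have -> : - (x2, - flat s x1) = (- x2, flat s x1) :> big_tangent p.
  by rewrite -[LHS]/(- x2, - - flat s x1) opprK.
by rewrite sharp_flat// sharpN sharp_flat// opprK.
Qed.

End SkewClassical.

(** * The Courant bracket of eigensections *)

Section CourantEigensections.
Variables (R : realType) (n : nat) (M : manifold R n) (s : two_form M).
Implicit Types (X Y Z : vector_field M) (b : one_form M) (p : M).

Lemma form_appN b X : form_app (- b) X = - form_app b X.
Proof. by apply: smoothfun_eq => p; rewrite smoothfunNE !form_appE form_atN dualNE. Qed.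

Lemma lie_derivativeN X b : lie_derivative X (- b) = - lie_derivative X b.
Proof.
apply: form_eq => Z p; rewrite form_atN dualNE !lie_derivativeE form_atN dualNE.
by rewrite form_appN tangentN; ring.
Qed.

Lemma courant_formE X b Y b' Z p : (courant (X, b) (Y, b')).2 p (Z p) =
  lie_derivative X b' p (Z p) - lie_derivative Y b p (Z p)
  + 2^-1 * (Z p (form_app b Y) - Z p (form_app b' X)).
Proof.
rewrite /courant -[(_, _).2]/(_ : one_form M) !form_atD form_atN form_atZ !dualDE dualNE dualZE.
by rewrite -tangentN -tangentD.
Qed.

Lemma form_app_flat X Y : form_app (flat_form s X) Y = tf_app s X Y.
Proof. exact: smoothfun_eq. Qed.

(* The section [(X, - i flat X)] of the complexified big tangent bundle,
   for the complex vector field [X = X1 + i X2]. *)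
Definition eigensection X1 X2 : cplx (big_section M) :=
  ((X1, flat_form s X2), (X2, - flat_form s X1)).

(** The factor [- i] brings the imaginary parts of the bracket and of the complex bilinear d sigma
    into the real covector, hence the mixed pairs [(X1, Y2)] and [(X2, Y1)]. *)
Lemma courant_eigensection_re X1 X2 Y1 Y2 Z p :
  let C := cplx_bilin (@courant R n M) (eigensection X1 X2) (eigensection Y1 Y2) in
  C.1.2 p (Z p) = flat s (C.2.1 p) (Z p)
    + ext_deriv s X1 Y2 Z p + ext_deriv s X2 Y1 Z p.
Proof.
move=> C.
have -> : C.1.2 = (courant (X1, flat_form s X2) (Y1, flat_form s Y2)).2
    - (courant (X2, - flat_form s X1) (Y2, - flat_form s Y1)).2 by [].
have -> : C.2.1 = lie_bracket X1 Y2 + lie_bracket X2 Y1 by [].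
rewrite form_atD form_atN dualDE dualNE !courant_formE vf_atD flatD dualDE.
have := cartan_identity s X1 Y2 Z p; have := cartan_identity s X2 Y1 Z p.
rewrite !lie_derivativeN !form_atN !dualNE !form_appN !form_app_flat !tangentN.
(* By skewness of sigma the two pairings in the Courant bracket add up, which compensates the factor
   1/2 and leaves the exact term of Cartan's formula. *)
rewrite (tf_appC s X1 Y2) (tf_appC s X2 Y1) !tangentN.
move=> e1 e2; lra.
Qed.

Lemma courant_eigensection_im X1 X2 Y1 Y2 Z p :
  let C := cplx_bilin (@courant R n M) (eigensection X1 X2) (eigensection Y1 Y2) in
  C.2.2 p (Z p) = - flat s (C.1.1 p) (Z p)
    - ext_deriv s X1 Y1 Z p + ext_deriv s X2 Y2 Z p.
Proof.
move=> C.
have -> : C.2.2 = (courant (X1, flat_form s X2) (Y2, - flat_form s Y1)).2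
    + (courant (X2, - flat_form s X1) (Y1, flat_form s Y2)).2 by [].
have -> : C.1.1 = lie_bracket X1 Y1 - lie_bracket X2 Y2 by [].
rewrite form_atD dualDE !courant_formE vf_atD vf_atN flatD flatN dualDE dualNE.
have := cartan_identity s X1 Y1 Z p; have := cartan_identity s X2 Y2 Z p.
rewrite !lie_derivativeN !form_atN !dualNE !form_appN !form_app_flat !tangentN.
rewrite (tf_appC s X1 Y1) (tf_appC s X2 Y2) !tangentN.
move=> e1 e2; lra.
Qed.

End CourantEigensections.

Theorem proposition3p6 (R : realType) (n : nat) (M : manifold R n)
    (V : forall p : M, set (tangent p)) (sigma : two_form M)
    (V_subbundle : is_subbundle V)
    (sigma_nondegenerate : nondegenerate_on sigma V)
    (TM_sum : forall p : M, direct_sum (V p) (ker_flat sigma p)) :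
  generalized_CRF (skew_classical_structure V sigma) <->
  involutive_subbundle V /\
  (forall (X Y Z : vector_field M) (p : M), V p (X p) -> V p (Y p) ->
    ext_deriv sigma X Y Z p = 0).
Proof.
have eigenP := i_eigenbundleP V_subbundle sigma_nondegenerate.
split=> [[_ CRF]|[invV dV]].
  (* Real fields suffice in this direction: the real vector part of the bracket is [[X, Y]] and its
     imaginary covector part carries d sigma. *)
  have real_section (X : vector_field M) : (forall p, V p (X p)) ->
      is_section_of (i_eigenbundle (skew_classical_structure V sigma)) (eigensection sigma X 0).
    move=> VX p.
    have V0p : V p ((0 : vector_field M) p) by rewrite vf_at0; exact: subbundle0.
    by apply/eigenP; split; [exact: VX|exact: V0p|by []|exact: form_atN].
  have CXY (X Y : vector_field M) p (VX : forall p, V p (X p)) (VY : forall p, V p (Y p)) :=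
    (eigenP p _).1 (CRF _ _ (real_section X VX) (real_section Y VY) p).
  have C11 (X Y : vector_field M) : lie_bracket X Y - lie_bracket 0 0 = lie_bracket X Y :> vector_field M.
    by rewrite lie_bracket0l subr0.
  have dV (X Y Z : vector_field M) p : (forall p, V p (X p)) -> (forall p, V p (Y p)) ->
      ext_deriv sigma X Y Z p = 0.
    move=> VX VY; have [_ _ _ E] := CXY X Y p VX VY.
    pose C := cplx_bilin (@courant R n M) (eigensection sigma X 0) (eigensection sigma Y 0).
    (* The same covector is computed from the eigenbundle equation and from the bracket formula; the
       discrepancy is d sigma. *)
    have e1 : C.2.2 p (Z p) = - flat sigma (C.1.1 p) (Z p).
      by rewrite -dualNE; exact: (congr1 (fun l : cotangent p => l (Z p)) E).
    have e2 : C.2.2 p (Z p) = - flat sigma (C.1.1 p) (Z p)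
        - ext_deriv sigma X Y Z p + ext_deriv sigma 0 0 Z p.
      exact: courant_eigensection_im.
    by move: e2; rewrite e1 ext_deriv0; lra.
  split=> [X Y VX VY p|X Y Z p VX VY].
    by have [VXY _ _ _] := CXY X Y p VX VY; rewrite -C11.
  (* [X] and [Y] are in [V] at [p] only. Their projections are in [V] everywhere and have the same
     values at [p], on which d sigma depends. *)
  pose P := V_projection V_subbundle sigma_nondegenerate.
  rewrite (@ext_deriv_pointwise _ _ _ sigma X Y (P X) (P Y)); last 2 first.
  - by rewrite V_projection_id.
  - by rewrite V_projection_id.
  by apply: dV => q; exact: V_projection_in.
split; first exact: skew_classical_generalized_F.
(* A section of the eigenbundle is determined by its vector part, so the bracket formulas cover
   arbitrary sections. *)
have section_eq A : is_section_of (i_eigenbundle (skew_classical_structure V sigma)) A ->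
    A = eigensection sigma A.1.1 A.2.1.
  case: A => -[X1 a1] [X2 a2] sA; congr ((_, _), (_, _)); apply: form_eq => Z p.
    have [_ _ E _] := (eigenP p _).1 (sA p).
    by have -> : a1 p = flat sigma (X2 p) by exact: E.
  have [_ _ _ E] := (eigenP p _).1 (sA p).
  by have -> : a2 p = - flat sigma (X1 p) by exact: E.
move=> A B sA sB p.
have VA q : V q (A.1.1 q) /\ V q (A.2.1 q) by have [] := (eigenP q _).1 (sA q).
have VB q : V q (B.1.1 q) /\ V q (B.2.1 q) by have [] := (eigenP q _).1 (sB q).
rewrite (section_eq _ sA) (section_eq _ sB).
move: (A.1.1) (A.2.1) (B.1.1) (B.2.1) VA VB => X1 X2 Y1 Y2 VX VY.
have VX1 q := (VX q).1; have VX2 q := (VX q).2.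
have VY1 q := (VY q).1; have VY2 q := (VY q).2.
have Vre : V p ((lie_bracket X1 Y1 - lie_bracket X2 Y2) p).
  rewrite vf_atD vf_atN; apply: subbundleD => //; first exact: invV.
  by apply: subbundleN => //; exact: invV.
have Vim : V p ((lie_bracket X1 Y2 + lie_bracket X2 Y1) p).
  by rewrite vf_atD; apply: subbundleD => //; exact: invV.
apply/eigenP; split; [exact: Vre|exact: Vim| |].
- apply: dual_eq => w; have [Z <-] := tangent_extension w.
  by rewrite [LHS]courant_eigensection_re !dV// !addr0.
- apply: dual_eq => w; have [Z <-] := tangent_extension w.
  by rewrite [LHS]courant_eigensection_im !dV// subr0 addr0 dualNE.
Qed.
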